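(* The mapping $$\breve q\mapsto (q^k)_{k\in\mathbb Z},$$ which sends $\breve q$ to the sequence of Fourier coefficients with respect to the angular variable $\theta$ of its expression $q$ in cylindrical coordinates, is an isometric isomorphism between $L^2(\breve\Omega)$ and the $l_2$-sum $\bigoplus_2\{L^2_{(k)}(\Omega)\colon k\in\mathbb Z\}$: $$\|\breve q\|_{L^2(\breve\Omega)}=\Bigl(\sum_{k\in\mathbb Z}\|q^k\|^2_{L^2_{(k)}(\Omega)}\Bigr)^{1/2}=\|(q^k)\|_{\bigoplus_2\{L^2_{(k)}(\Omega)\colon k\in\mathbb Z\}},$$ where, for all $k\in\mathbb Z$, $L^2_{(k)}(\Omega)=L^2_1(\Omega)$.
   Context: Domain. $\breve\Omega\subset\mathbb R^3$ is a bounded domain invariant by rotation around the $z$-axis. Its half section (meridian domain) $\Omega\subset\{(r,z): r>0\}$ is polygonal; $\Gamma_0$ denotes the interior of the part of $\partial\Omega$ contained in the axis $r=0$, and $\breve\Omega$ is obtained by rotating $\Omega$ (together with $\Gamma_0$) around the $z$-axis. Cylindrical coordinates are $x=r\cos\theta$, $y=r\sin\theta$, $z$, with $\theta\in(-\pi,\pi]$, and $\tilde\Omega=\{(r,\theta,z): (r,z)\in\Omega,\ -\pi<\theta\le\pi\}$. All functions are complex-valued. Fourier coefficients. For $\breve q$ on $\breve\Omega$ write $\breve q(x,y,z)=q(r,\theta,z)$ and $q(r,\theta,z)=\frac1{\sqrt{2\pi}}\sum_{k\in\mathbb Z}q^k(r,z)e^{ik\theta}$, i.e. $q^k(r,z)=\frac1{\sqrt{2\pi}}\int_{-\pi}^{\pi}q(r,\theta,z)e^{-ik\theta}\,d\theta$.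 Spaces. $L^2_1(\Omega)$ is the space of measurable $v:\Omega\to\mathbb C$ with $\|v\|_{L^2_1(\Omega)}^2=\int_\Omega|v|^2\,r\,dr\,dz<\infty$. $l_2$-sum. For normed spaces $X_k$, $k\in\mathbb Z$, $\bigoplus_2\{X_k\colon k\in\mathbb Z\}$ is the subspace of the Cartesian product of the $X_k$ consisting of all sequences $(x^k)$ with $\|(x^k)\|=(\sum_{k\in\mathbb Z}\|x^k\|_{X_k}^2)^{1/2}<\infty$. *)

(* Defs.v *)
From HB Require Import structures.
From mathcomp Require Import all_boot all_order all_algebra.
From mathcomp Require Import ring.
From mathcomp Require Import complex.
From mathcomp Require Import all_classical all_reals all_analysis measurable_realfun.

Set Implicit Arguments.
Unset Strict Implicit.
Unset Printing Implicit Defensive.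

Import Order.TTheory GRing.Theory Num.Theory.
Import numFieldNormedType.Exports.

Local Open Scope classical_set_scope.
Local Open Scope ring_scope.
Local Open Scope complex_scope.
Local Open Scope quotient_scope.

Notation normc := Normc.normc.

Section normc_facts.
Variable R : realType.
Implicit Types z w : R[i].

Lemma normcE z : `|z| = (normc z)%:C.
Proof. by case: z. Qed.

Lemma normc_sqr z : normc z ^+ 2 = complex.Re z ^+ 2 + complex.Im z ^+ 2.
Proof. by case: z => a b /=; rewrite sqr_sqrtr// addr_ge0// sqr_ge0. Qed.

Lemma normc_ge0 z : 0 <= normc z.
Proof. by case: z => a b /=; exact: sqrtr_ge0. Qed.

Lemma normcZ z w : normc (z * w) = normc z * normc w.
Proof. exact: Normc.normcM. Qed.

Lemma normc_triangle z w : normc (z + w) <= normc z + normc w.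
Proof. exact: le_normcD. Qed.

End normc_facts.

(* The right-hand side minus the left-hand side is (bx - ay)^2 / (ab). Minimizing
   over a and b gives the triangle inequality of "square root of a sum of squares"
   norms without Cauchy-Schwarz. *)
Lemma sqrD_weighted (R : realFieldType) (a b x y : R) : 0 < a -> 0 < b ->
  (x + y) ^+ 2 <= (a + b) / a * x ^+ 2 + (a + b) / b * y ^+ 2.
Proof.
move=> a0 b0; rewrite -subr_ge0.
have -> : (a + b) / a * x ^+ 2 + (a + b) / b * y ^+ 2 - (x + y) ^+ 2 =
   (b * x - a * y) ^+ 2 / (a * b) by field; rewrite !gt_eqF.
by rewrite divr_ge0 ?sqr_ge0// mulr_ge0 ?ltW.
Qed.

Lemma sqrt_triangle (R : realType) (s x y : R) : 0 <= x -> 0 <= y ->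
  (forall a b, 0 < a -> 0 < b -> s <= (a + b) / a * x + (a + b) / b * y) ->
  Num.sqrt s <= Num.sqrt x + Num.sqrt y.
Proof.
move=> x0 y0 H; apply/ler_addgt0Pl => e e0.
have [e2 sx sy] : [/\ 0 < e / 2, 0 <= Num.sqrt x & 0 <= Num.sqrt y].
  by rewrite !sqrtr_ge0 divr_gt0.
set a := Num.sqrt x + e / 2; set b := Num.sqrt y + e / 2.
have a0 : 0 < a by rewrite ltr_wpDl.
have b0 : 0 < b by rewrite ltr_wpDl.
have -> : e + (Num.sqrt x + Num.sqrt y) = a + b.
  by rewrite /a /b [in LHS](splitr e); ring.
have xa : x <= a ^+ 2.
  by rewrite -[leLHS]sqr_sqrtr// ler_sqr ?nnegrE ?(ltW a0)// lerDl ltW.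
have yb : y <= b ^+ 2.
  by rewrite -[leLHS]sqr_sqrtr// ler_sqr ?nnegrE ?(ltW b0)// lerDl ltW.
rewrite -[leRHS](gtr0_norm (addr_gt0 a0 b0)) -sqrtr_sqr ler_wsqrtr//.
apply: (le_trans (H _ _ a0 b0)).
have -> : (a + b) ^+ 2 = (a + b) / a * a ^+ 2 + (a + b) / b * b ^+ 2.
  by field; rewrite !gt_eqF.
by rewrite lerD// ler_wpM2l// divr_ge0 ?ltW// addr_gt0.
Qed.

Record weighted_set d (T : measurableType d) (R : realType) := WeightedSet {
  wset :> set T ;
  weight : T -> R ;
  measurable_wset : measurable wset ;
  measurable_weight : measurable_fun wset weight ;
  weight_gt0 : forall x, wset x -> 0 < weight x }.

Section L2fun.
Context d (T : measurableType d) (R : realType).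
Variables (mu : {measure set T -> \bar R}) (W : weighted_set T R).
Implicit Types f g : T -> R[i].

Definition measurable_cfun f :=
  measurable_fun W (fun x => complex.Re (f x)) /\
  measurable_fun W (fun x => complex.Im (f x)).

Definition sqnorm_density f x : \bar R := (normc (f x) ^+ 2 * weight W x)%:E.

Definition L2integral f : \bar R := \int[mu]_(x in W) sqnorm_density f x.

(* Functions are defined on all of T, but only their values on W matter. *)
Definition L2mem : {pred T -> R[i]} :=
  fun f => `[< measurable_cfun f /\ (L2integral f < +oo)%E >].

Lemma L2memP f : f \in L2mem <-> measurable_cfun f /\ (L2integral f < +oo)%E.
Proof. by split => [/asboolP|?]//; apply/asboolP. Qed.

Lemma sqnorm_density_ge0 f x : wset W x -> (0 <= sqnorm_density f x)%E.
Proof. by move=> Wx; rewrite lee_fin mulr_ge0 ?sqr_ge0// ltW// weight_gt0. Qed.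

Lemma measurable_sqnorm_density f :
  measurable_cfun f -> measurable_fun W (sqnorm_density f).
Proof.
move=> [mr mi]; apply/measurable_EFinP; apply: measurable_funM.
  under eq_fun do rewrite normc_sqr.
  by apply: measurable_funD; exact: measurable_funX.
exact: measurable_weight.
Qed.

Lemma L2integral_ge0 f : (0 <= L2integral f)%E.
Proof. by apply: integral_ge0 => x; exact: sqnorm_density_ge0. Qed.

Lemma L2integral_fineK f : f \in L2mem -> (fine (L2integral f))%:E = L2integral f.
Proof.
move=> /L2memP[_ foo]; rewrite fineK// ge0_fin_numE//; exact: L2integral_ge0.
Qed.

Lemma measurable_cfun_lin (c : R[i]) f g :
  measurable_cfun f -> measurable_cfun g -> measurable_cfun (c *: f + g).
Proof.
move=> [fr fi] [gr gi]; split.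
  rewrite (_ : (fun x => _) = fun x =>
    (complex.Re c * complex.Re (f x) - complex.Im c * complex.Im (f x))
    + complex.Re (g x)); last first.
    apply/funext => x; rewrite -[(c *: f + g) x]/(c * f x + g x).
    by case: c (f x) (g x) => [? ?] [? ?] [? ?].
  apply: measurable_funD => //.
  by apply: measurable_funB; exact: measurable_funM.
rewrite (_ : (fun x => _) = fun x =>
  (complex.Re c * complex.Im (f x) + complex.Im c * complex.Re (f x))
  + complex.Im (g x)); last first.
  apply/funext => x; rewrite -[(c *: f + g) x]/(c * f x + g x).
  by case: c (f x) (g x) => [? ?] [? ?] [? ?].
apply: measurable_funD => //.
by apply: measurable_funD; exact: measurable_funM.
Qed.

Lemma L2integral_comb (k l : R) f g h : 0 <= k -> 0 <= l ->
  measurable_cfun f -> measurable_cfun g -> measurable_cfun h ->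
  (forall x, wset W x ->
    normc (h x) ^+ 2 <= k * normc (f x) ^+ 2 + l * normc (g x) ^+ 2) ->
  (L2integral h <= k%:E * L2integral f + l%:E * L2integral g)%E.
Proof.
move=> k0 l0 mf mg mh hle.
have mW := measurable_wset W.
have d0 u x : wset W x -> (0 <= sqnorm_density u x)%E.
  exact: sqnorm_density_ge0.
have md u : measurable_cfun u -> measurable_fun W (sqnorm_density u).
  exact: measurable_sqnorm_density.
have eZ (c : R) u : 0 <= c -> measurable_cfun u ->
    (c%:E * L2integral u = \int[mu]_(x in W) (c%:E * sqnorm_density u x))%E.
  move=> c0 mu'; rewrite (ge0_integralZl mu mW (md _ mu')) ?lee_fin//.
  by move=> x; exact: d0.
have c0 (c : R) u x : 0 <= c -> wset W x -> (0 <= c%:E * sqnorm_density u x)%E.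
  by move=> ? Wx; rewrite mule_ge0 ?d0 ?lee_fin//.
have mc (c : R) u : measurable_cfun u ->
    measurable_fun W (fun x => c%:E * sqnorm_density u x)%E.
  by move=> /md; exact: measurable_funeM.
rewrite !eZ// -ge0_integralD//; first last.
- exact: mc.
- by move=> x; exact: c0.
- exact: mc.
- by move=> x; exact: c0.
apply: ge0_le_integral => //.
- by move=> x; exact: d0.
- exact: md.
- by apply: emeasurable_funD; exact: mc.
move=> x Wx; rewrite /sqnorm_density -!EFinM -EFinD lee_fin.
by rewrite (mulrA k) (mulrA l) -mulrDl ler_wpM2r ?hle// ltW// weight_gt0.
Qed.

Lemma L2mem0 : 0 \in L2mem.
Proof.
apply/L2memP; split; first by split; exact: measurable_cst.
rewrite /L2integral integral0_eq// => x _.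
by rewrite /sqnorm_density Normc.normc0 expr0n mul0r.
Qed.

Lemma L2mem_submod_closed : submod_closed L2mem.
Proof.
split=> [|c f g /[dup] fL /L2memP[mf _] /[dup] gL /L2memP[mg _]].
  exact: L2mem0.
have mh := measurable_cfun_lin c mf mg.
apply/L2memP; split => //.
apply: (@le_lt_trans _ _ ((2 * normc c ^+ 2)%:E * L2integral f
                          + 2%:E * L2integral g)%E); last first.
  by rewrite -(L2integral_fineK fL) -(L2integral_fineK gL) -!EFinM -EFinD ltry.
apply: L2integral_comb => //; first by rewrite mulr_ge0 ?sqr_ge0.
move=> x _; rewrite -[(c *: f + g) x]/(c * f x + g x).
apply: (@le_trans _ _ ((normc c * normc (f x) + normc (g x)) ^+ 2)).
  rewrite ler_sqr ?nnegrE ?addr_ge0 ?mulr_ge0 ?normc_ge0//.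
  by rewrite -normcZ normc_triangle.
have := @sqrD_weighted R 1 1 (normc c * normc (f x)) (normc (g x)) ltr01 ltr01.
by rewrite !divr1 exprMn mulrA.
Qed.

HB.instance Definition _ :=
  GRing.isSubmodClosed.Build _ _ L2mem L2mem_submod_closed.

Record L2fun := L2Fun { L2fun_val :> T -> R[i] ; _ : L2fun_val \in L2mem }.

HB.instance Definition _ := [isSub for L2fun_val].
HB.instance Definition _ := [Choice of L2fun by <:].
HB.instance Definition _ := [SubChoice_isSubLmodule of L2fun by <:].

Lemma L2fun_mem (f : L2fun) : (f : T -> R[i]) \in L2mem.
Proof. exact: valP. Qed.

Lemma L2fun_measurable (f : L2fun) : measurable_cfun f.
Proof. by have /L2memP[] := L2fun_mem f. Qed.

Definition L2fun_norm (f : L2fun) : R := Num.sqrt (fine (L2integral f)).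

Definition L2null : {pred L2fun} :=
  fun f : L2fun => `[< {ae mu, forall x, wset W x -> f x = 0} >].

Lemma L2nullP (f : L2fun) : f \in L2null <-> {ae mu, forall x, wset W x -> f x = 0}.
Proof. by split => [/asboolP|?]//; apply/asboolP. Qed.

Lemma L2null_zmod_closed : zmod_closed L2null.
Proof.
split=> [|f g /L2nullP f0 /L2nullP g0]; apply/L2nullP.
  by apply: aeW => x _.
apply: filterS2 f0 g0 => x f0 g0 Wx.
by rewrite -[(f - g) x]/(f x - g x) f0// g0// subrr.
Qed.

HB.instance Definition _ :=
  GRing.isZmodClosed.Build L2fun L2null L2null_zmod_closed.

Lemma L2nullZ (c : R[i]) (f : L2fun) : f \in L2null -> c *: f \in L2null.
Proof.
move=> /L2nullP f0; apply/L2nullP; apply: filterS f0 => x f0 Wx.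
by rewrite (_ : L2fun_val (c *: f) x = c * f x)// f0// mulr0.
Qed.

Definition L2 : Type := Quotient.quot L2null.
HB.instance Definition _ := GRing.Zmodule.on L2.
HB.instance Definition _ := EqQuotient.on L2.

Definition L2class (f : L2fun) : L2 := \pi_L2 f.

Lemma L2class_repr (q : L2) : L2class (repr q) = q.
Proof. exact: reprK. Qed.

Lemma L2classP (f g : L2fun) :
  L2class f = L2class g <-> {ae mu, forall x, wset W x -> f x = g x}.
Proof.
have -> : (L2class f = L2class g) <-> (f - g \in L2null).
  by rewrite Quotient.idealrBE; split => /eqP.
by split => [/L2nullP|] h; [|apply/L2nullP]; apply: filterS h => x h Wx;
  have := h Wx; rewrite -[(f - g) x]/(f x - g x);
  [move=> /eqP; rewrite subr_eq0 => /eqP|move=> ->; rewrite subrr].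
Qed.

Lemma L2classD (f g : L2fun) : L2class (f + g) = L2class f + L2class g.
Proof. exact: (raddfD (\pi_(Quotient.quot L2null))). Qed.

Definition L2scale (c : R[i]) (q : L2) : L2 := L2class (c *: repr q).

Lemma L2classZ (c : R[i]) (f : L2fun) : L2class (c *: f) = L2scale c (L2class f).
Proof.
apply/L2classP.
have /L2classP : L2class f = L2class (repr (L2class f)) by rewrite L2class_repr.
apply: filterS => x h Wx.
by rewrite -[LHS]/(c * f x) -[RHS]/(c * repr (L2class f) x) h.
Qed.

Lemma L2scaleA a b (q : L2) : L2scale a (L2scale b q) = L2scale (a * b) q.
Proof. by rewrite -[q]L2class_repr -!L2classZ scalerA. Qed.

Lemma L2scale1 : left_id 1 L2scale.
Proof. by move=> q; rewrite -[q]L2class_repr -!L2classZ scale1r. Qed.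

Lemma L2scaleDr : right_distributive L2scale +%R.
Proof.
move=> c p q; rewrite -[p]L2class_repr -[q]L2class_repr.
by rewrite -L2classD -!L2classZ -L2classD scalerDr.
Qed.

Lemma L2scaleDl q : {morph L2scale^~ q : a b / a + b}.
Proof.
by move=> a b; rewrite -[q]L2class_repr -!L2classZ -L2classD scalerDl.
Qed.

HB.instance Definition _ :=
  GRing.Zmodule_isLmodule.Build R[i] L2 L2scaleA L2scale1 L2scaleDr L2scaleDl.

Definition L2norm (q : L2) : R[i] := (L2fun_norm (repr q))%:C.

Lemma L2integral_ae (f g : L2fun) :
  {ae mu, forall x, wset W x -> f x = g x} -> L2integral f = L2integral g.
Proof.
move=> fg; apply: ae_eq_integral => //.
- exact: measurable_wset.
- by apply: measurable_sqnorm_density; exact: L2fun_measurable.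
- by apply: measurable_sqnorm_density; exact: L2fun_measurable.
by apply: filterS fg => x fg Wx; rewrite /sqnorm_density fg.
Qed.

Lemma L2norm_class (f : L2fun) : L2norm (L2class f) = (L2fun_norm f)%:C.
Proof.
rewrite /L2norm /L2fun_norm (@L2integral_ae _ f)//.
by apply/L2classP; rewrite L2class_repr.
Qed.

Lemma L2fun_normD (f g : L2fun) :
  L2fun_norm (f + g) <= L2fun_norm f + L2fun_norm g.
Proof.
apply: sqrt_triangle => [||a b a0 b0].
- exact/fine_ge0/L2integral_ge0.
- exact/fine_ge0/L2integral_ge0.
rewrite -lee_fin EFinD !EFinM !L2integral_fineK ?L2fun_mem//.
have ab0 : 0 <= a + b by rewrite ltW// addr_gt0.
apply: L2integral_comb; rewrite ?divr_ge0 ?(ltW a0) ?(ltW b0)//.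
- exact: L2fun_measurable.
- exact: L2fun_measurable.
- exact: (L2fun_measurable (f + g)).
move=> x _; apply: (@le_trans _ _ ((normc (f x) + normc (g x)) ^+ 2)).
  rewrite ler_sqr ?nnegrE ?addr_ge0 ?normc_ge0//.
  exact: normc_triangle.
exact: sqrD_weighted.
Qed.

Lemma L2fun_normZ (c : R[i]) (f : L2fun) :
  L2fun_norm (c *: f) = normc c * L2fun_norm f.
Proof.
rewrite /L2fun_norm.
have -> : L2integral (c *: f : L2fun) = ((normc c ^+ 2)%:E * L2integral f)%E.
  rewrite /L2integral -ge0_integralZl//=.
  - apply: eq_integral => x _; rewrite /sqnorm_density.
    transitivity ((normc (c * f x) ^+ 2 * weight W x)%:E) => //.
    by rewrite normcZ exprMn -mulrA EFinM.
  - exact: measurable_wset.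
  - by apply: measurable_sqnorm_density; exact: L2fun_measurable.
  - by move=> x Wx; exact: sqnorm_density_ge0.
  - by rewrite lee_fin sqr_ge0.
rewrite -(L2integral_fineK (L2fun_mem f)) -EFinM /= sqrtrM ?sqr_ge0//.
by rewrite sqrtr_sqr ger0_norm// normc_ge0.
Qed.

Lemma L2fun_norm0 (f : L2fun) : L2fun_norm f = 0 -> f \in L2null.
Proof.
move=> /eqP; rewrite sqrtr_eq0 => f0; apply/L2nullP.
have {}f0 : L2integral f = 0%E.
  apply/eqP; rewrite eq_le L2integral_ge0 andbT.
  by rewrite -(L2integral_fineK (L2fun_mem f)) lee_fin.
have mf := measurable_sqnorm_density (L2fun_measurable f).
have /(ae_eq_integral_abs mu (measurable_wset W) mf) :
    (\int[mu]_(x in W) `|sqnorm_density f x|)%E = 0%E.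
  rewrite -f0; apply: eq_integral => x; rewrite inE => Wx.
  by rewrite gee0_abs// sqnorm_density_ge0.
apply: filterS => x h Wx; have := h Wx.
rewrite /sqnorm_density => -[] /eqP; rewrite mulf_eq0 sqrf_eq0.
by rewrite [weight W x == 0]gt_eqF ?weight_gt0// orbF => /eqP/Normc.eq0_normc.
Qed.

Lemma L2normD (p q : L2) : L2norm (p + q) <= L2norm p + L2norm q.
Proof.
rewrite -[p]L2class_repr -[q]L2class_repr -L2classD !L2norm_class.
by rewrite -rmorphD lecR L2fun_normD.
Qed.

Lemma L2normZ (c : R[i]) (q : L2) : L2norm (c *: q) = `|c| * L2norm q.
Proof.
rewrite -[q]L2class_repr -[_ *: _]L2classZ !L2norm_class L2fun_normZ.
by rewrite rmorphM normcE.
Qed.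

Lemma L2norm_eq0 (q : L2) : L2norm q = 0 -> q = 0.
Proof.
rewrite -[q]L2class_repr L2norm_class => -[] /L2fun_norm0 h.
have -> : 0 = L2class 0 by rewrite -[LHS](subrr (L2class 0)) -[RHS]addr0
  -[in RHS](subrr (L2class 0)) addrA -L2classD addr0.
by apply/L2classP; move/L2nullP: h.
Qed.

HB.instance Definition _ :=
  Lmodule_isNormed.Build R[i] L2 L2normD L2normZ L2norm_eq0.

End L2fun.

Section l2sum.
Context (R : realType) (I : choiceType) (X : I -> normedModType R[i]).

(* The norm of a complex normed space takes its values in the real elements of
   R[i]; Re recovers the real number. *)
Definition l2sq (x : forall i, X i) : \bar R :=
  \esum_(i in [set: I]) (complex.Re `|x i| ^+ 2)%:E.

Record l2sum := L2Sum {
  l2seq :> forall i, X i ;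
  l2seq_finite : (l2sq l2seq < +oo)%E }.

HB.instance Definition _ := gen_eqMixin l2sum.
HB.instance Definition _ := gen_choiceMixin l2sum.

Lemma l2sum_eq (x y : l2sum) : (forall i, x i = y i) -> x = y.
Proof.
case: x y => [x hx] [y hy] /= xy.
have e : x = y by apply: functional_extensionality_dep.
by subst y; congr L2Sum; exact: Prop_irrelevance.
Qed.

Lemma l2sq_ge0 x : (0 <= l2sq x)%E.
Proof. by apply: esum_ge0 => i _; rewrite lee_fin sqr_ge0. Qed.

Lemma esum_scale (k : R) (a : I -> R) : 0 <= k -> (forall i, 0 <= a i) ->
  (\esum_(i in [set: I]) (k * a i)%:E <= k%:E * \esum_(i in [set: I]) (a i)%:E)%E.
Proof.
move=> k0 a0; apply: ge_ereal_sup => _ [F [finF _] <-].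
under eq_fsbigr do rewrite EFinM.
rewrite -ge0_mule_fsumr; last by move=> i; rewrite lee_fin.
by apply: lee_wpmul2l; rewrite ?lee_fin//; apply: esum_ge; exists F.
Qed.

Lemma l2sq_comb (k l : R) x y z : 0 <= k -> 0 <= l ->
  (forall i, complex.Re `|z i| ^+ 2 <=
             k * complex.Re `|x i| ^+ 2 + l * complex.Re `|y i| ^+ 2) ->
  (l2sq z <= k%:E * l2sq x + l%:E * l2sq y)%E.
Proof.
move=> k0 l0 h.
apply: (@le_trans _ _ (\esum_(i in [set: I]) ((k * complex.Re `|x i| ^+ 2)%:E
   + (l * complex.Re `|y i| ^+ 2)%:E)%E)).
  by apply: le_esum => i _; rewrite -EFinD lee_fin.
rewrite esumD; [|by move=> i _; rewrite lee_fin mulr_ge0// sqr_ge0..].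
by apply: leeD; apply: esum_scale => // i; exact: sqr_ge0.
Qed.

Lemma l2sq_fineK (x : l2sum) : (fine (l2sq x))%:E = l2sq x.
Proof. by rewrite fineK// ge0_fin_numE ?l2sq_ge0//; exact: l2seq_finite. Qed.

Lemma Re_norm_ge0 i (u : X i) : 0 <= complex.Re `|u|.
Proof. by have := normr_ge0 u; rewrite lecE => /andP[]. Qed.

Lemma Re_normD i (u v : X i) :
  complex.Re `|u + v| <= complex.Re `|u| + complex.Re `|v|.
Proof.
have := ler_normD u v; rewrite lecE => /andP[_].
by case: `|u| `|v| => [? ?] [? ?].
Qed.

Lemma Re_normZ i (c : R[i]) (u : X i) :
  complex.Re `|c *: u| = normc c * complex.Re `|u|.
Proof. by rewrite normrZ normcE; case: `|u| => ? ? /=; rewrite mul0r subr0. Qed.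

Lemma l2sum0_subproof : (l2sq (fun i => 0%R : X i) < +oo)%E.
Proof. by rewrite /l2sq esum1// => i _; rewrite normr0 expr0n. Qed.

Lemma l2sumN_subproof (x : l2sum) : (l2sq (fun i => (- x i)%R) < +oo)%E.
Proof.
rewrite /l2sq; under eq_esum do rewrite normrN.
exact: l2seq_finite.
Qed.

Lemma l2sumD_subproof (x y : l2sum) : (l2sq (fun i => (x i + y i)%R) < +oo)%E.
Proof.
apply: (@le_lt_trans _ _ (2%:E * l2sq x + 2%:E * l2sq y)%E); last first.
  by rewrite -(l2sq_fineK x) -(l2sq_fineK y) -!EFinM -EFinD ltry.
apply: l2sq_comb => // i.
apply: (@le_trans _ _ ((complex.Re `|x i| + complex.Re `|y i|) ^+ 2)).
  by rewrite ler_sqr ?nnegrE ?addr_ge0 ?Re_norm_ge0// Re_normD.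
have := @sqrD_weighted R 1 1 (complex.Re `|x i|) (complex.Re `|y i|) ltr01 ltr01.
by rewrite !divr1.
Qed.

Lemma l2sqZ_le (c : R[i]) (x : l2sum) :
  (l2sq (fun i => (c *: x i)%R) <= (normc c ^+ 2)%:E * l2sq x)%E.
Proof.
rewrite /l2sq; under eq_esum do rewrite Re_normZ exprMn.
by apply: esum_scale => [|i]; exact: sqr_ge0.
Qed.

Lemma l2sumZ_subproof (c : R[i]) (x : l2sum) :
  (l2sq (fun i => (c *: x i)%R) < +oo)%E.
Proof.
apply: le_lt_trans (l2sqZ_le c x) _.
by rewrite -l2sq_fineK -EFinM ltry.
Qed.

Definition l2sum_zero := L2Sum l2sum0_subproof.
Definition l2sum_opp x := L2Sum (l2sumN_subproof x).
Definition l2sum_add x y := L2Sum (l2sumD_subproof x y).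
Definition l2sum_scale c x := L2Sum (l2sumZ_subproof c x).

Lemma l2sum_addA : associative l2sum_add.
Proof. by move=> x y z; apply: l2sum_eq => i /=; rewrite addrA. Qed.
Lemma l2sum_addC : commutative l2sum_add.
Proof. by move=> x y; apply: l2sum_eq => i /=; rewrite addrC. Qed.
Lemma l2sum_add0 : left_id l2sum_zero l2sum_add.
Proof. by move=> x; apply: l2sum_eq => i /=; rewrite add0r. Qed.
Lemma l2sum_addN : left_inverse l2sum_zero l2sum_opp l2sum_add.
Proof. by move=> x; apply: l2sum_eq => i /=; rewrite addNr. Qed.

HB.instance Definition _ :=
  GRing.isZmodule.Build l2sum l2sum_addA l2sum_addC l2sum_add0 l2sum_addN.

Lemma l2sum_scaleA a b x : l2sum_scale a (l2sum_scale b x) = l2sum_scale (a * b) x.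
Proof. by apply: l2sum_eq => i /=; rewrite scalerA. Qed.
Lemma l2sum_scale1 : left_id 1 l2sum_scale.
Proof. by move=> x; apply: l2sum_eq => i /=; rewrite scale1r. Qed.
Lemma l2sum_scaleDr : right_distributive l2sum_scale +%R.
Proof. by move=> c x y; apply: l2sum_eq => i /=; rewrite scalerDr. Qed.
Lemma l2sum_scaleDl x : {morph l2sum_scale^~ x : a b / a + b}.
Proof. by move=> a b; apply: l2sum_eq => i /=; rewrite scalerDl. Qed.

HB.instance Definition _ := GRing.Zmodule_isLmodule.Build R[i] l2sum
  l2sum_scaleA l2sum_scale1 l2sum_scaleDr l2sum_scaleDl.

Definition l2sum_norm (x : l2sum) : R[i] := (Num.sqrt (fine (l2sq x)))%:C.

Lemma l2sum_normD (x y : l2sum) : l2sum_norm (x + y) <= l2sum_norm x + l2sum_norm y.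
Proof.
rewrite -rmorphD lecR; apply: sqrt_triangle => [||a b a0 b0].
- exact/fine_ge0/l2sq_ge0.
- exact/fine_ge0/l2sq_ge0.
rewrite -lee_fin EFinD !EFinM !l2sq_fineK.
have ab0 : 0 <= a + b by rewrite ltW// addr_gt0.
apply: l2sq_comb; rewrite ?divr_ge0 ?(ltW a0) ?(ltW b0)// => i.
apply: (@le_trans _ _ ((complex.Re `|x i| + complex.Re `|y i|) ^+ 2)).
  by rewrite ler_sqr ?nnegrE ?addr_ge0 ?Re_norm_ge0// Re_normD.
exact: sqrD_weighted.
Qed.

Lemma l2sum_normZ_le (c : R[i]) (x : l2sum) :
  l2sum_norm (c *: x) <= `|c| * l2sum_norm x.
Proof.
rewrite normcE -rmorphM lecR -[normc c]ger0_norm ?normc_ge0// -sqrtr_sqr.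
rewrite -sqrtrM ?sqr_ge0// ler_wsqrtr// -lee_fin EFinM !l2sq_fineK.
exact: l2sqZ_le.
Qed.

Lemma l2sum_normZ (c : R[i]) (x : l2sum) : l2sum_norm (c *: x) = `|c| * l2sum_norm x.
Proof.
apply/eqP; rewrite eq_le l2sum_normZ_le /=.
have [->|c0] := eqVneq c 0.
  by rewrite normr0 mul0r ler0c sqrtr_ge0.
have := l2sum_normZ_le c^-1 (c *: x).
rewrite scalerA mulVf// scale1r normfV => h.
by rewrite mulrC -ler_pdivlMr ?normr_gt0// mulrC.
Qed.

Lemma l2sum_norm_eq0 (x : l2sum) : l2sum_norm x = 0 -> x = 0.
Proof.
move=> -[] /eqP; rewrite sqrtr_eq0 => x0; apply: l2sum_eq => i.
have : (l2sq x <= 0)%E by rewrite -l2sq_fineK lee_fin.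
have : ((complex.Re `|x i| ^+ 2)%:E <= l2sq x)%E.
  apply: esum_ge; exists [set i]; first by split => //; exact: finite_set1.
  by rewrite fsbig_set1.
move=> /le_trans /[apply]; rewrite lee_fin => h.
have /eqP : complex.Re `|x i| ^+ 2 == 0 by rewrite eq_le h sqr_ge0.
move/eqP; rewrite sqrf_eq0 => /eqP r0; apply/normr0_eq0.
have := normr_ge0 (x i); rewrite lecE => /andP[/eqP im0 _].
by case: `|x i| r0 im0 => a b /= -> ->.
Qed.

HB.instance Definition _ := Lmodule_isNormed.Build R[i] l2sum
  l2sum_normD l2sum_normZ l2sum_norm_eq0.

End l2sum.

Definition countable_base (T : topologicalType) (B : nat -> set T) :=
  forall x U, nbhs x U -> exists n, B n x /\ B n `<=` U.

Lemma countable_base_prod (S T : topologicalType) A B :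
  @countable_base S A -> @countable_base T B ->
  @countable_base (S * T)%type (fun n =>
    if @unpickle (nat * nat)%type n is Some ij then A ij.1 `*` B ij.2 else set0).
Proof.
move=> hA hB [x y] U [[V W] /= [/hA[i [Ax AV]] /hB[j [By BW]]] VWU].
exists (pickle (i, j)); rewrite pickleK; split=> // -[s t] [/= /AV Vs /BW Wt].
exact: VWU.
Qed.

Lemma countable_base_open (T : topologicalType) B (U : set T) :
  countable_base B -> open U -> U = \bigcup_(n in [set n | B n `<=` U]) B n.
Proof.
move=> hB oU; apply/seteqP; split => [x Ux|x [n nU Bx]]; last exact: nU.
have [n [Bx BU]] : exists n, B n x /\ B n `<=` U by apply: hB; exact: open_nbhs_nbhs.
by exists n.
Qed.

Section borel_open.
Variable R : realType.

Definition rat_itv (n : nat) : set R :=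
  if @unpickle (rat * rat)%type n is Some ab then `]ratr ab.1, ratr ab.2[%classic
  else set0.

Lemma countable_base_rat_itv : countable_base rat_itv.
Proof.
move=> x U /nbhs_ballP[e /= e0 eU].
have [a] := @rat_in_itvoo R (x - e) x ltac:(by rewrite ltrBlDr ltrDl).
have [b] := @rat_in_itvoo R x (x + e) ltac:(by rewrite ltrDl).
rewrite !in_itv /= => /andP[xb bxe] /andP[xea ax].
exists (pickle (a, b)); rewrite /rat_itv pickleK /= in_itv /= ax xb; split => //.
move=> y /=; rewrite in_itv /= => /andP[ay yb]; apply: eU.
rewrite /ball /= ltr_distlC.
by rewrite (lt_trans xea ay) (lt_trans yb bxe).
Qed.

Let M := measurableTypeR R.

Lemma measurable_rat_itv n : measurable (rat_itv n : set M).
Proof. by rewrite /rat_itv; case: unpickle => [?|]. Qed.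

Lemma open_measurable2 (U : set (R * R)) : open U -> measurable (U : set (M * M)).
Proof.
move=> oU.
rewrite (countable_base_open
  (countable_base_prod countable_base_rat_itv countable_base_rat_itv) oU).
apply: bigcup_measurable => n _; case: unpickle => [[i j]|] //=.
by apply: measurableX; exact: measurable_rat_itv.
Qed.

Lemma open_measurable3 (U : set (R * R * R)) :
  open U -> measurable (U : set (M * M * M)).
Proof.
move=> oU.
rewrite (countable_base_open (countable_base_prod
  (countable_base_prod countable_base_rat_itv countable_base_rat_itv)
  countable_base_rat_itv) oU).
apply: bigcup_measurable => n _; case: unpickle => [[i j]|] //=.
apply: measurableX; last exact: measurable_rat_itv.
case: unpickle => [[k l]|] //=.
by apply: measurableX; exact: measurable_rat_itv.
Qed.

End borel_open.

Definition domain (T : topologicalType) (A : set T) :=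
  [/\ A !=set0, open A & connected A].

Definition boundary (T : topologicalType) (A : set T) : set T :=
  closure A `\` interior A.

Section axisymmetric.
Variable R : realType.

Definition segment (a b : R * R) : set (R * R) :=
  [set (1 - t) *: a + t *: b | t in `[0, 1]%classic].

(* Re-entrant corners, holes and slits are allowed, isolated boundary points are
   not. *)
Definition polygonal (O : set (R * R)) :=
  [/\ domain O, bounded_set O &
    exists2 s : seq ((R * R) * (R * R)),
      (forall e, e \in s -> e.1 != e.2) &
      boundary O = \bigcup_(e in [set` s]) segment e.1 e.2].

(* Points of the half-plane are pairs (r, z). The interior is taken in the axis
   r = 0, a line, and not in the plane. *)
Definition Gamma0 (O : set (R * R)) : set (R * R) :=
  [set p | p.1 = 0 /\ interior [set z | boundary O (0, z)] p.2].

Definition cylindrical (r theta z : R) : R * R * R :=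
  (r * cos theta, r * sin theta, z).

Definition rotate (O : set (R * R)) : set (R * R * R) :=
  [set x | exists r theta z, [/\ (O `|` Gamma0 O) (r, z),
    - pi < theta <= pi & x = cylindrical r theta z]].

Record axisymmetric_domain := AxisymmetricDomain {
  meridian : set (R * R) ;
  meridian_halfplane : meridian `<=` [set p | 0 < p.1] ;
  meridian_polygonal : polygonal meridian ;
  rotate_domain : domain (rotate meridian) ;
  rotate_bounded : bounded_set (rotate meridian) }.

Local Notation B := (measurableTypeR R).

Definition lebesgue2 : {measure set (B * B)%type -> \bar R} :=
  (lebesgue_measure \x lebesgue_measure)%E.

Definition lebesgue3 : {measure set (B * B * B)%type -> \bar R} :=
  ((lebesgue_measure \x lebesgue_measure) \x lebesgue_measure)%E.

Variable M : axisymmetric_domain.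

Lemma measurable_meridian : measurable (meridian M : set (B * B)).
Proof.
by apply: open_measurable2; case: (meridian_polygonal M) => -[].
Qed.

Lemma measurable_rotate : measurable (rotate (meridian M) : set (B * B * B)).
Proof. by apply: open_measurable3; case: (rotate_domain M). Qed.

Definition space_set : weighted_set (B * B * B)%type R :=
  @WeightedSet _ (B * B * B)%type R (rotate (meridian M)) (fun=> 1) measurable_rotate
    (@measurable_cst _ _ _ _ _ _) (fun _ _ => ltr01).

Definition meridian_set : weighted_set (B * B)%type R :=
  @WeightedSet _ (B * B)%type R (meridian M) fst measurable_meridian
    (measurable_funS measurableT (@subsetT _ _) measurable_fst)
    (@meridian_halfplane M).

(* Borel representatives give the same spaces of classes as Lebesgue measurable
   ones. *)
Definition L2_space : normedModType R[i] := L2 lebesgue3 space_set.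
Definition L2_1 : normedModType R[i] := L2 lebesgue2 meridian_set.
Definition L2_ (k : int) : normedModType R[i] := L2_1.

End axisymmetric.

Section fourier.
Variable R : realType.
Local Notation B := (measurableTypeR R).
Local Notation theta_range := (`]- pi, pi]%classic : set B).

Definition expi (t : R) : R[i] := cos t +i* sin t.

Definition cintegrable (h : R -> R[i]) :=
  lebesgue_measure.-integrable theta_range (EFin \o (fun t => complex.Re (h t))) /\
  lebesgue_measure.-integrable theta_range (EFin \o (fun t => complex.Im (h t))).

Definition cintegral (h : R -> R[i]) : R[i] :=
  (\int[lebesgue_measure]_(t in theta_range) complex.Re (h t))%R +i*
  (\int[lebesgue_measure]_(t in theta_range) complex.Im (h t))%R.

Definition fourier_integrand (q : R * R * R -> R[i]) (k : int) (p : R * R) :=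
  fun theta : R =>
    q (cylindrical p.1 theta p.2) * expi (- (k%:~R * theta)).

Definition fourier_coef (q : R * R * R -> R[i]) (k : int) (p : R * R) : R[i] :=
  ((Num.sqrt (2 * pi))^-1)%:C * cintegral (fourier_integrand q k p).

(* The k-th coefficient of a class q is the class v; the integral defining it
   need only converge for almost every (r, z). *)
Definition is_fourier_coef (M : axisymmetric_domain R)
    (q : L2_space M) (k : int) (v : L2_ M k) :=
  forall (f : L2fun (lebesgue3 R) (space_set M))
         (g : L2fun (lebesgue2 R) (meridian_set M)),
    L2class f = q -> L2class g = v ->
    {ae lebesgue2 R, forall p, meridian M p ->
      cintegrable (fourier_integrand f k p) /\ g p = fourier_coef f k p}.

End fourier.

(* Main.v *)
(** In cylindrical coordinates the squared norm of a function is the integral over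
    the meridian domain, with weight [r], of the squared norms of its restrictions
    to circles. On a circle, with [c k] the Fourier coefficients of [h] and [e k]
    the normalized exponentials, expanding the square gives
    [|h - c * e k|^2 + |c k|^2 = |h|^2 + |c k - c|^2] for every scalar [c].
    Integrating over the meridian domain gives the same identity for the
    coefficient maps [F k : L2 -> L2_1] and the maps [L k : v |-> v * e k], and
    [F j (L k v)] is [v] if [j = k] and [0] otherwise.

    A function all of whose coefficients vanish is zero: on almost every circle it
    is orthogonal to the trigonometric polynomials, and the indicator function of
    an arc is a bounded pointwise limit of those, by means of the functions
    [(1 - x ^ n) ^ (2 ^ n)], which tend to [1] if [0 <= x < 1/2] and to [0] if
    [1/2 < x <= 1].

    Since [L2] is complete, every square summable family [v] is the family of the
    coefficients of [sum_k L k (v k)]. The map is thus surjective, and applying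
    this to the coefficients of [q] gives [q = sum_k L k (F k q)], hence the
    equality of the norms. *)

Require Import Defs.
From HB Require Import structures.
From mathcomp Require Import all_boot all_order all_algebra.
From mathcomp Require Import ring lra.
From mathcomp Require Import complex.
From mathcomp Require Import all_classical all_reals all_analysis measurable_realfun.

Set Implicit Arguments.
Unset Strict Implicit.
Unset Printing Implicit Defensive.

Import Order.TTheory GRing.Theory Num.Theory.
Import numFieldNormedType.Exports.

Local Open Scope classical_set_scope.
Local Open Scope ring_scope.
Local Open Scope complex_scope.

(** * Change of variables *)

(** The definitions provide norms and no inner product, so orthogonality is carried by the norm
    identity, whose two sides are sums of nonnegative terms. It makes sense before anything is known
    to be finite: taking [c] to be the coefficient shows that coefficients are square integrable,
    and taking the function to be zero shows that lifting [v] preserves its norm. Together with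
    biorthogonality, the same identity computes the norms of finite sums in the abstract argument.

    The change to cylindrical coordinates avoids the Jacobian of a map of the plane. Each
    substitution acts on one real variable inside an iterated integral and is proved by comparing
    two measures on half-open intervals; Tonelli's theorem does the rest for nonnegative functions.

    Coefficients exist circle by circle and almost everywhere, while the statement is about classes.
    The square integrability of almost every circle is the bridge between the two levels.
    Completeness is used only along sequences with steps at most [4^-1 ^+ n], a rate that the
    partial sums can be chosen to satisfy. *)

Section density.
Local Open Scope ereal_scope.
Context d1 d2 (T1 : measurableType d1) (T2 : measurableType d2) (R : realType).
Variables (mu : {measure set T1 -> \bar R}) (nu : {measure set T2 -> \bar R}).
Variables (F : T1 -> T2) (phi : T1 -> R).
Hypotheses (mF : measurable_fun setT F) (mphi : measurable_fun setT phi).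
Hypothesis phi0 : forall t, (0 <= phi t)%R.
Hypothesis nuE : forall A, measurable A ->
  nu A = \int[mu]_(t in F @^-1` A) (phi t)%:E.

Import HBNNSimple.

(** Monotone convergence along simple approximations of [G] reduces both sides to simple functions,
    for which the formula is a finite combination of instances of [nuE]. *)
Lemma ge0_integral_density (G : T2 -> \bar R) :
  measurable_fun setT G -> (forall y, 0 <= G y) ->
  \int[nu]_y G y = \int[mu]_t (G (F t) * (phi t)%:E).
Proof.
move=> mG G0; pose g_ := nnsfun_approx measurableT mG.
have mgF n : measurable_fun setT (fun t => (g_ n (F t) * phi t)%R).
  by apply: measurable_funM => //; exact: measurableT_comp.
transitivity (limn (fun n => \int[nu]_y (g_ n y)%:E)).
  rewrite -monotone_convergence//.
  - apply: eq_integral => y _; apply/esym/cvg_lim => //.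
    by apply: cvg_nnsfun_approx => // *; exact: G0.
  - by move=> n; exact/measurable_EFinP/measurable_funP.
  - by move=> n y _; rewrite lee_fin.
  - by move=> y _ m n mn; rewrite lee_fin; exact/lefP/nd_nnsfun_approx.
transitivity (limn (fun n => \int[mu]_t (g_ n (F t) * phi t)%:E)); last first.
  rewrite -monotone_convergence//.
  - apply: eq_integral => t _; apply/cvg_lim => //.
    under eq_fun do rewrite EFinM.
    by apply: cvgeZr => //; apply: cvg_nnsfun_approx => // *; exact: G0.
  - by move=> n; exact/measurable_EFinP.
  - by move=> n y _; rewrite lee_fin mulr_ge0.
  - move=> y _ m n mn; rewrite lee_fin ler_wpM2r//.
    exact/lefP/nd_nnsfun_approx.
congr (limn _); apply/funext => n.
under eq_integral do rewrite fimfunE -fsumEFin//.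
rewrite ge0_integral_fsum//; last 2 first.
- by move=> y; exact/measurable_EFinP/measurable_funM.
- by move=> y x _; rewrite nnfun_muleindic_ge0.
under [RHS]eq_integral.
  move=> t _; rewrite fimfunE mulr_fsuml -fsumEFin//; over.
rewrite /= ge0_integral_fsum//; last 2 first.
- move=> y; apply/measurable_EFinP/measurable_funM => //.
  apply: measurable_funM => //.
  by apply: measurableT_comp => //; exact: measurable_indic.
- move=> y x _; rewrite EFinM mule_ge0 ?lee_fin//.
  by rewrite -lee_fin nnfun_muleindic_ge0.
apply: eq_fsbigr => r /set_mem [y _ yr].
have r0 : (0 <= r)%R by rewrite -yr.
have mA : measurable (g_ n @^-1` [set r]) by exact: measurable_funPTI.
rewrite integralZl_indic_nnsfun// integral_indic// setIT nuE// integral_mkcond.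
under [RHS]eq_integral do rewrite -mulrA EFinM.
rewrite ge0_integralZl//.
- congr (_ * _); apply: eq_integral => t _; rewrite patchE indicE.
  rewrite (_ : (t \in _) = (F t \in g_ n @^-1` [set r]))//.
  by case: ifP => _; rewrite ?mul1r ?mul0r.
- apply/measurable_EFinP/measurable_funM => //.
  by apply: measurableT_comp => //; exact: measurable_indic.
- by move=> t _; rewrite lee_fin mulr_ge0.
Qed.

End density.

Section lebesgue_substitution.
Local Open Scope ereal_scope.
Context d1 (T1 : measurableType d1) (R : realType).
Variables (mu : {measure set T1 -> \bar R}).
Local Notation B := (measurableTypeR R).
Variables (F : T1 -> B) (phi : T1 -> R).
Hypotheses (mF : measurable_fun setT F) (mphi : measurable_fun setT phi).
Hypothesis phi0 : forall t, (0 <= phi t)%R.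

Let nu (A : set B) : \bar R := \int[mu]_(t in F @^-1` A) (phi t)%:E.

Let nu0 : nu set0 = 0.
Proof. by rewrite /nu preimage_set0 integral_set0. Qed.

Let nu_ge0 A : 0 <= nu A.
Proof. by apply: integral_ge0 => t _; rewrite lee_fin. Qed.

Let nu_sigma : semi_sigma_additive nu.
Proof.
move=> A mA tA mUA; rewrite /nu preimage_bigcup.
have mFA n : measurable (F @^-1` A n) by rewrite -[_ @^-1` _]setTI; exact: mF.
apply: (@semi_sigma_additive_nng_induced _ _ _ mu (EFin \o phi)) => //.
- exact/measurable_EFinP.
- by move=> i j _ _ [t [Ai Aj]]; exact: (tA i j I I (ex_intro _ (F t) (conj Ai Aj))).
- exact: bigcup_measurable.
Qed.

HB.instance Definition _ := isMeasure.Build _ _ _ nu nu0 nu_ge0 nu_sigma.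

(** The image [nu] of the measure with density [phi] agrees with Lebesgue measure on half-open
    intervals, hence on all Borel sets. The interval condition is all that is asked of [F], so a
    periodic map such as [tan] is admissible once [phi] selects one of its branches. *)
Lemma ge0_lebesgue_substitution (G : B -> \bar R) :
  (forall a b : R, (a < b)%R ->
    \int[mu]_(t in F @^-1` `]a, b]) (phi t)%:E = (b - a)%:E) ->
  measurable_fun setT G -> (forall y, 0 <= G y) ->
  \int[lebesgue_measure]_y G y = \int[mu]_t (G (F t) * (phi t)%:E).
Proof.
move=> h mG G0; apply: ge0_integral_density => // A mA.
rewrite -[RHS]/(nu A); apply: (@lebesgue_measure_unique _ nu) => // X oX.
have [->|[[a b] /= ab ->]] : X = set0 \/ exists2 x, (x.1 < x.2)%R & X = `]x.1, x.2]%classic.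
- by apply/ocitvP.
- by rewrite !measure0.
- by rewrite lebesgue_measure_itv/= lte_fin ab [RHS]h// EFinB.
Qed.

End lebesgue_substitution.

(** * Affine and tangent substitutions on the line *)

Section one_dimensional_substitutions.
Variable R : realType.
Local Notation B := (measurableTypeR R).
Local Notation mu := (@lebesgue_measure R).

Lemma measurable_funV d (T : measurableType d) (D : set T) (f : T -> R) :
  measurable_fun D f -> measurable_fun D (fun x => (f x)^-1).
Proof.
move=> mf; have mV : measurable_fun [set: B] (@GRing.inv R).
  have m0 : measurable (~` [set 0] : set B) by exact: measurableC.
  (* Inversion is continuous only off 0, where it takes its default value, so the singleton is
     treated apart. *)
  rewrite -(setvU [set 0 : B]) setUC; apply/measurable_funU => //; split.
    exact: measurable_fun_set1.
  apply: open_continuous_measurable_fun.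
    by apply: closed_openC; exact: closed_eq.
  by move=> x; rewrite inE/= => /eqP x0; exact: inv_continuous.
exact: (measurableT_comp mV).
Qed.

Lemma measurable_sin : measurable_fun [set: B] (@sin R).
Proof. by apply: continuous_measurable_fun; exact: continuous_sin. Qed.

Lemma measurable_cos : measurable_fun [set: B] (@cos R).
Proof. by apply: continuous_measurable_fun; exact: continuous_cos. Qed.

Local Open Scope ereal_scope.

Lemma ge0_integral_affine (a b : R) (G : B -> \bar R) : (a != 0)%R ->
  measurable_fun setT G -> (forall y, 0 <= G y) ->
  \int[mu]_y G y = \int[mu]_t (G (a * t + b)%R * `|a|%:E).
Proof.
move=> a0 mG G0; apply: ge0_lebesgue_substitution => // [|c d cd].
  by apply: measurable_funD => //; exact: measurable_funM.
rewrite integral_cst//; last first.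
  rewrite -[_ @^-1` _]setTI.
  have /(_ measurableT) : measurable_fun [set: B] (fun t : B => a * t + b)%R.
    by apply: measurable_funD => //; exact: measurable_funM.
  exact.
move: a0; rewrite neq_lt => /orP[a0|a0].
- rewrite (_ : _ @^-1` _ = `[(d - b) / a, (c - b) / a[%classic)%R; last first.
    apply/seteqP; split => x/=; rewrite !in_itv/= ler_ndivrMr// ltr_ndivlMr//;
    by rewrite ltrBlDr lerBrDr (mulrC x) andbC.
  rewrite /= lebesgue_measure_itv/= lte_fin ltr_nM2r ?invr_lt0// ltrD2r cd.
  rewrite ltr0_norm// -EFinD -EFinM; congr EFin; field.
  by rewrite lt_eqF.
- rewrite (_ : _ @^-1` _ = `](c - b) / a, (d - b) / a]%classic)%R; last first.
    apply/seteqP; split => x/=; rewrite !in_itv/= ler_pdivlMr// ltr_pdivrMr//;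
    by rewrite ltrBlDr lerBrDr (mulrC x).
  rewrite /= lebesgue_measure_itv/= lte_fin ltr_pM2r ?invr_gt0// ltrD2r cd.
  rewrite gtr0_norm// -EFinD -EFinM; congr EFin; field.
  by rewrite gt_eqF.
Qed.

Local Notation halfcircle := (`](- (pi / 2))%R, (pi / 2)%R[%classic : set B).

Lemma measurable_tan : measurable_fun [set: B] (@tan R).
Proof.
rewrite /tan; apply: measurable_funM; first exact: measurable_sin.
apply: measurable_funV; exact: measurable_cos.
Qed.

Lemma ge0_integral_tan (G : B -> \bar R) :
  measurable_fun setT G -> (forall y, 0 <= G y) ->
  \int[mu]_y G y =
  \int[mu]_(t in halfcircle) (G (tan t) * (cos t ^- 2)%:E).
Proof.
move=> mG G0.
(* The indicator keeps one branch of the tangent. There the preimage of []c, d]] is []atan c, atan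
   d]], over which the derivative [cos t ^- 2] integrates to [d - c]. *)
pose phi (t : B) := (\1_halfcircle t * cos t ^- 2)%R.
rewrite (@ge0_lebesgue_substitution _ B _ mu tan phi)//; first last.
- move=> c d cd.
  rewrite integral_mkcond/=.
  transitivity (\int[mu]_(t in `[atan c, atan d]) (cos t ^- 2)%:E).
    rewrite -(@integral_itv_obnd_cbnd _ (atan c) (BRight (atan d)))//; last first.
      apply/measurable_EFinP/measurable_funTS; apply: measurable_funV.
      by apply: measurable_funX; exact: measurable_cos.
    rewrite [RHS]integral_mkcond; apply: eq_integral => t _.
    rewrite !patchE (_ : (t \in `]atan c, atan d]%classic)
        = (t \in tan @^-1` `]c, d]) && (t \in halfcircle)); last first.
      apply/idP/andP.
        rewrite !inE/= !in_itv/= => /andP[ct td].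
        have tlb := lt_trans (atan_gtNpi2 c) ct.
        have tub := le_lt_trans td (atan_ltpi2 d).
        have tin : t \in `](- (pi / 2)), (pi / 2)[%R by rewrite in_itv/= tlb tub.
        rewrite tlb tub; split => //.
        rewrite -[X in (X < _)%R]atanK -[X in (_ <= X)%R]atanK.
        rewrite ltr_tan ?in_itv/= ?atan_gtNpi2 ?atan_ltpi2 ?tlb ?tub// ct/=.
        by rewrite leNgt ltr_tan ?in_itv/= ?atan_gtNpi2 ?atan_ltpi2 ?tlb ?tub// -leNgt.
      rewrite !inE/= !in_itv/= => -[/andP[ct td] tin].
      have tin' : t \in `](- (pi / 2)), (pi / 2)[%R by rewrite in_itv.
      rewrite -(tanK tin') (lt_atan ct)/=.
      exact: le_atan.
    rewrite /phi indicE; case: ifP => //= _; case: ifP => //= _.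
      by rewrite mul1r.
    by rewrite mul0r.
  have in1 : forall x, (atan c <= x <= atan d)%R -> cos x != 0%R.
    move=> x /andP[cx xd]; rewrite gt_eqF// cos_gt0_pihalf//.
    by rewrite (lt_le_trans (atan_gtNpi2 c) cx) (le_lt_trans xd (atan_ltpi2 d)).
  have dt x : (atan c <= x <= atan d)%R -> {for x, continuous (@tan R)}.
    by move=> /in1; exact: continuous_tan.
  rewrite (@continuous_FTC2 _ _ tan).
  + by rewrite !atanK EFinB.
  + exact: lt_atan.
  + apply: continuous_in_subspaceT => x; rewrite inE/= in_itv/= => xin.
    rewrite -[continuous_at _ _]/({for x, continuous (fun y : R => (cos y ^+ 2)^-1)})%R.
    apply: continuousV; first by rewrite expf_neq0// in1.
    apply: (@continuous_comp _ _ _ (@cos R) (fun y => y ^+ 2))%R.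
      exact: continuous_cos.
    exact: exprn_continuous.
  + split.
    * move=> x; rewrite in_itv/= => /andP[cx xd].
      by apply: derivable_tan; rewrite in1// !ltW.
    * by apply: cvg_at_right_filter; apply: dt; rewrite lexx ltW//; exact: lt_atan.
    * by apply: cvg_at_left_filter; apply: dt; rewrite lexx andbT ltW//; exact: lt_atan.
  + move=> x; rewrite in_itv/= => /andP[cx xd].
    have /is_derive_tan h : cos x != 0%R by rewrite in1// !ltW.
    by rewrite derive1E derive_val.
- by move=> t; rewrite mulr_ge0// invr_ge0 sqr_ge0.
- apply: measurable_funM; first exact: measurable_indic.
  by apply: measurable_funV; apply: measurable_funX; exact: measurable_cos.
- exact: measurable_tan.
rewrite [RHS]integral_mkcond; apply: eq_integral => t _.
rewrite patchE /phi indicE; case: ifP => _; first by rewrite mul1r.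
by rewrite mul0r mule0.
Qed.

End one_dimensional_substitutions.

Lemma ge0_integral_swap d1 d2 (T1 : measurableType d1) (T2 : measurableType d2)
  (R : realType) (m1 : {sigma_finite_measure set T1 -> \bar R})
  (m2 : {sigma_finite_measure set T2 -> \bar R}) (D1 : set T1) (D2 : set T2)
  (K : T1 -> T2 -> \bar R) :
  measurable D1 -> measurable D2 ->
  measurable_fun (D1 `*` D2) (fun p => K p.1 p.2) ->
  (forall x y, D1 x -> D2 y -> (0 <= K x y)%E) ->
  (\int[m1]_(x in D1) \int[m2]_(y in D2) K x y =
   \int[m2]_(y in D2) \int[m1]_(x in D1) K x y)%E.
Proof.
move=> mD1 mD2 mK K0.
pose K' : T1 * T2 -> \bar R := (fun p => K p.1 p.2) \_ (D1 `*` D2).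
have K'E x y : K' (x, y) = if (x \in D1) && (y \in D2) then K x y else 0%E.
  by rewrite /K' patchE in_setX.
transitivity (\int[m1]_x \int[m2]_y K' (x, y))%E.
  rewrite integral_mkcond; apply: eq_integral => x _; rewrite patchE.
  case: ifPn => xD; last first.
    by rewrite integral0_eq// => y _; rewrite K'E (negbTE xD).
  rewrite integral_mkcond; apply: eq_integral => y _.
  by rewrite K'E xD patchE.
rewrite fubini_tonelli; last 2 first.
- by apply/(measurable_restrictT _ _).1 => //; exact: measurableX.
- move=> [x y]; rewrite K'E; case: ifP => // /andP[].
  by rewrite !inE; exact: K0.
rewrite [RHS]integral_mkcond; apply: eq_integral => y _; rewrite patchE.
case: ifPn => yD; last first.
  by rewrite integral0_eq// => x _; rewrite K'E (negbTE yD) andbF.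
rewrite [RHS]integral_mkcond; apply: eq_integral => x _.
by rewrite K'E yD patchE andbT.
Qed.

(** * Polar coordinates in the right half-plane *)

Section polar_coordinates.
Variable R : realType.
Local Notation B := (measurableTypeR R).
Local Notation mu := (@lebesgue_measure R).
Local Open Scope ereal_scope.

Lemma ge0_integral_itvoc_split (a b c : R) (f : R -> \bar R) : (a <= b <= c)%R ->
  measurable_fun [set: B] f -> (forall x, 0 <= f x) ->
  \int[mu]_(x in `]a, c]) f x =
  \int[mu]_(x in `]a, b]) f x + \int[mu]_(x in `]b, c]) f x.
Proof.
move=> /andP[ab bc] mf f0.
rewrite (@itv_bndbnd_setU _ _ (BRight a) (BRight b) (BRight c)) ?bnd_simp//.
rewrite ge0_integral_setU//.
- exact: measurable_funTS.
- by apply/disj_setPS => x/= []; rewrite !in_itv/= => /andP[_ xb] /andP[]; rewrite ltNge xb.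
Qed.

Lemma ge0_integral_itvoc_shift (a b c : R) (f : R -> \bar R) :
  measurable_fun [set: B] f -> (forall x, 0 <= f x) ->
  \int[mu]_(x in `](a + c)%R, (b + c)%R]) f x = \int[mu]_(x in `]a, b]) f (x + c)%R.
Proof.
move=> mf f0; rewrite integral_mkcond (@ge0_integral_affine _ 1 c)//; first last.
- by move=> y; rewrite patchE; case: ifP.
- exact/(measurable_restrictT _ _).1/measurable_funTS.
rewrite [RHS]integral_mkcond; apply: eq_integral => x _.
rewrite normr1 mule1 mul1r !patchE.
rewrite (_ : (x + c \in _)%R = (x \in `]a, b]%classic))//.
by apply/idP/idP; rewrite !inE/= !in_itv/= ltrD2r lerD2r.
Qed.

(** The half circle shifted by [pi] runs from [pi / 2] to [3 * pi / 2]; periodicity brings its part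
    beyond [pi] back to []- pi, - (pi / 2)]]. This matches the decomposition of the plane into two
    half-planes. *)
Lemma ge0_integral_circle_split (f : R -> \bar R) :
  measurable_fun [set: B] f -> (forall x, 0 <= f x) ->
  (forall x, f (x + pi *+ 2)%R = f x) ->
  \int[mu]_(t in `](- pi)%R, pi]) f t =
  \int[mu]_(t in `](- (pi / 2))%R, (pi / 2)%R[) f t +
  \int[mu]_(t in `](- (pi / 2))%R, (pi / 2)%R[) f (t + pi)%R.
Proof.
move=> mf f0 fp.
have pi0 := @pi_gt0 R.
have mfs : measurable_fun [set: B] (fun t : R => f (t + pi)%R).
  by apply: measurableT_comp => //; exact: measurable_funD.
rewrite (integral_itv_bndo_bndc (measurable_funTS mf)).
rewrite (integral_itv_bndo_bndc (measurable_funTS mfs)).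
rewrite (@ge0_integral_itvoc_split _ (- (pi / 2))%R)//; last by apply/andP; split; lra.
rewrite (@ge0_integral_itvoc_split (- (pi / 2)) (pi / 2))%R//; last by apply/andP; split; lra.
rewrite -[in RHS]ge0_integral_itvoc_shift//.
rewrite (@ge0_integral_itvoc_split (- (pi / 2) + pi) pi (pi / 2 + pi))%R//; last by apply/andP; split; lra.
rewrite addeC -addeA; congr (_ + _).
rewrite (_ : - (pi / 2) + pi = pi / 2)%R; last by field.
congr (_ + _).
rewrite (_ : pi / 2 + pi = - (pi / 2) + pi *+ 2)%R; last by field.
transitivity (\int[mu]_(x in `](- pi + pi *+ 2)%R, (- (pi / 2) + pi *+ 2)%R]) f x).
  rewrite ge0_integral_itvoc_shift//.
  by apply: eq_integral => x _; rewrite fp.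
by rewrite (_ : - pi + pi *+ 2 = pi)%R//; ring.
Qed.

(* Substitute [y = x tan t] in the inner integral, exchange the integrals, then
   substitute [x = r cos t]. *)
Lemma ge0_integral_halfplane (G : B * B -> \bar R) :
  measurable_fun setT G -> (forall p, 0 <= G p) ->
  \int[mu]_(x in `]0%R, +oo[) \int[mu]_y G (x, y) =
  \int[mu]_(r in `]0%R, +oo[) \int[mu]_(t in `](- (pi / 2))%R, (pi / 2)%R[)
    (G (r * cos t, r * sin t)%R * r%:E).
Proof.
move=> mG G0.
have mtan : measurable_fun [set: B * B] (fun p : B * B => tan p.2).
  exact: (measurableT_comp (@measurable_tan R)).
have mcos : measurable_fun [set: B * B] (fun p : B * B => cos p.2).
  exact: (measurableT_comp (@measurable_cos R)).
have msin : measurable_fun [set: B * B] (fun p : B * B => sin p.2).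
  exact: (measurableT_comp (@measurable_sin R)).
have mcos2 : measurable_fun [set: B * B] (fun p : B * B => cos p.2 ^- 2)%R.
  by apply: measurable_funV; exact: measurable_funX.
pose K (x t : B) := G (x, x * tan t)%R * (x * cos t ^- 2)%:E.
pose L (r t : B) := G (r * cos t, r * sin t)%R * r%:E.
transitivity (\int[mu]_(x in `]0%R, +oo[) \int[mu]_(t in `](- (pi / 2))%R, (pi / 2)%R[) K x t).
  apply: eq_integral => x; rewrite inE/= in_itv/= andbT => x0.
  have mGx : measurable_fun [set: B] (fun y => G (x, y)).
    exact: measurableT_comp.
  rewrite (@ge0_integral_affine _ x 0)//; last by rewrite gt_eqF.
  rewrite ge0_integral_tan//.
  - apply: eq_integral => t _.
    by rewrite addr0 gtr0_norm// /K EFinM muleA.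
  - apply: emeasurable_funM => //; apply: (measurableT_comp mGx).
    by apply: measurable_funD => //; exact: measurable_funM.
  - by move=> y; rewrite mule_ge0.
have mdom : measurable (`]0%R, +oo[%classic : set B) by [].
have marc : measurable (`](- (pi / 2))%R, (pi / 2)%R[%classic : set B) by [].
have mK : measurable_fun setT (fun p : B * B => K p.1 p.2).
  apply: emeasurable_funM.
    apply: (measurableT_comp mG); apply: measurable_fun_pair => //; exact: measurable_funM.
  by apply/measurable_EFinP; exact: measurable_funM.
have mL : measurable_fun setT (fun p : B * B => L p.1 p.2).
  apply: emeasurable_funM.
    by apply: (measurableT_comp mG); apply: measurable_fun_pair => //; exact: measurable_funM.
  by apply/measurable_EFinP.
have K0 x t : `]0%R, +oo[%classic x -> 0 <= K x t.
  rewrite /= in_itv/= andbT => x0.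
  by rewrite /K mule_ge0// lee_fin mulr_ge0 ?invr_ge0 ?sqr_ge0// ltW.
have L0 r t : `]0%R, +oo[%classic r -> 0 <= L r t.
  by rewrite /= in_itv/= andbT => r0; rewrite /L mule_ge0// lee_fin ltW.
transitivity (\int[mu]_(t in `](- (pi / 2))%R, (pi / 2)%R[) \int[mu]_(x in `]0%R, +oo[) K x t).
  have := @ge0_integral_swap _ _ B B R mu mu _ _ K mdom marc (measurable_funTS mK).
  by apply => x t x0 _; exact: K0.
transitivity (\int[mu]_(t in `](- (pi / 2))%R, (pi / 2)%R[) \int[mu]_(x in `]0%R, +oo[) L x t); last first.
  apply/esym; have := @ge0_integral_swap _ _ B B R mu mu _ _ L mdom marc (measurable_funTS mL).
  by apply => x t x0 _; exact: L0.
apply: eq_integral => t; rewrite inE/= in_itv/= => tin.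
have ct := cos_gt0_pihalf tin; rewrite /K /L.
rewrite integral_mkcond (@ge0_integral_affine _ (cos t) 0)//; first last.
- move=> y; rewrite patchE; case: ifPn => //; rewrite inE/= in_itv/= andbT => y0.
  by rewrite mule_ge0// lee_fin mulr_ge0 ?invr_ge0 ?sqr_ge0// ltW.
- apply/(measurable_restrictT _ _).1 => //; apply/measurable_funTS/emeasurable_funM.
    apply: (measurableT_comp mG); apply: measurable_fun_pair => //; exact: measurable_funM.
  by apply/measurable_EFinP; exact: measurable_funM.
- by rewrite gt_eqF.
rewrite [RHS]integral_mkcond; apply: eq_integral => r _.
rewrite !patchE addr0 (_ : (cos t * r \in _)%R = (r \in `]0%R, +oo[%classic)); last first.
  by apply/idP/idP; rewrite !inE/= !in_itv/= !andbT pmulr_rgt0.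
case: ifP => _; last by rewrite mul0e.
rewrite -muleA -EFinM gtr0_norm// (mulrC (cos t) r) -(mulrA r (cos t) (tan t)).
have -> : (cos t * tan t = sin t)%R by rewrite /tan mulrCA divff ?mulr1// gt_eqF.
by congr (_ * _%:E); field; rewrite gt_eqF.
Qed.

End polar_coordinates.

Lemma ge0_measurable_fun_integral d1 d2 (T1 : measurableType d1)
  (T2 : measurableType d2) (R : realType)
  (m2 : {sigma_finite_measure set T2 -> \bar R}) (D1 : set T1) (D2 : set T2)
  (K : T1 -> T2 -> \bar R) :
  measurable D1 -> measurable D2 ->
  measurable_fun (D1 `*` D2) (fun p => K p.1 p.2) ->
  (forall x y, D1 x -> D2 y -> (0 <= K x y)%E) ->
  measurable_fun D1 (fun x => \int[m2]_(y in D2) K x y)%E.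
Proof.
move=> mD1 mD2 mK K0; have mD := measurableX mD1 mD2.
pose K' : T1 * T2 -> \bar R := (fun p => K p.1 p.2) \_ (D1 `*` D2).
have K'0 p : (0 <= K' p)%E.
  rewrite /K' patchE; case: ifPn => //; rewrite inE => -[]; exact: K0.
have mK' : measurable_fun setT K' by apply: (measurable_restrictT _ mD).1.
apply: (eq_measurable_fun (fubini_F m2 K')) => [x xD|]; last first.
  by apply: measurable_funTS; exact: measurable_fun_fubini_tonelli_F.
rewrite [RHS]integral_mkcond /fubini_F.
by apply: eq_integral => y _; rewrite /K' !patchE in_setX xD.
Qed.

(** * Polar coordinates in the plane, cylindrical coordinates in space *)

Section cylindrical_coordinates.
Variable R : realType.
Local Notation B := (measurableTypeR R).
Local Notation mu := (@lebesgue_measure R).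
Local Open Scope ereal_scope.

(** The point reflection carries the left half-plane to the right one and adds [pi] to the angle, so
    two instances of the half-plane formula add up to the whole circle. The line [x = 0] between
    them is negligible. *)
Lemma ge0_integral_polar (G : B * B -> \bar R) :
  measurable_fun setT G -> (forall p, 0 <= G p) ->
  \int[mu \x mu]_p G p =
  \int[mu]_(r in `]0%R, +oo[) \int[mu]_(t in `](- pi)%R, pi])
    (G (r * cos t, r * sin t)%R * r%:E).
Proof.
move=> mG G0.
pose I x := \int[mu]_y G (x, y).
have mI : measurable_fun [set: B] I.
  exact: measurable_fun_fubini_tonelli_F.
have I0 x : 0 <= I x by apply: integral_ge0.
have mGN : measurable_fun [set: B * B] (fun p : B * B => G (- p.1, - p.2)%R).
  by apply: (measurableT_comp mG); apply: measurable_fun_pair;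
    exact: (measurableT_comp (@oppr_measurable R setT)).
(* The sign [s] is 1 for the right half-plane and -1 for its reflection. *)
have mpol s : measurable_fun [set: B * B] (fun p : B * B =>
    G (s * (p.1 * cos p.2), s * (p.1 * sin p.2))%R * p.1%:E).
  apply: emeasurable_funM; last exact/measurable_EFinP.
  apply: (measurableT_comp mG); apply: measurable_fun_pair;
  do 2 apply: measurable_funM => //.
  - exact: (measurableT_comp (@measurable_cos R)).
  - exact: (measurableT_comp (@measurable_sin R)).
transitivity (\int[mu]_x I x); first exact: fubini_tonelli1.
rewrite -(setUv `]0%R, +oo[) ge0_integral_setU//; first last.
- by apply/disj_setPS; rewrite setICr.
- exact: measurable_funTS.
- exact: measurableC.
rewrite (_ : \int[mu]_(x in ~` `]0%R, +oo[) I x =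
    \int[mu]_(x in `]0%R, +oo[) \int[mu]_y G (- x, - y)%R); last first.
  rewrite setCitvr -integral_itv_bndo_bndc; last exact: measurable_funTS.
  rewrite integral_mkcond (@ge0_integral_affine _ (-1) 0)//; first last.
  - by move=> y; rewrite patchE; case: ifP.
  - by apply/(measurable_restrictT _ _).1 => //; exact: measurable_funTS.
  rewrite [RHS]integral_mkcond; apply: eq_integral => x _.
  rewrite normrN normr1 mule1 mulN1r addr0 !patchE.
  rewrite (_ : (- x \in _)%R = (x \in `]0%R, +oo[%classic)); last first.
    by apply/idP/idP; rewrite !inE/= !in_itv/= ?andbT oppr_lt0.
  case: ifP => // _; rewrite /I.
  rewrite (@ge0_integral_affine _ (-1) 0)//.
  - by apply: eq_integral => y _; rewrite normrN normr1 mule1 mulN1r addr0.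
  - exact: measurableT_comp.
rewrite !(@ge0_integral_halfplane _ G)// (@ge0_integral_halfplane _ (fun p => G (- p.1, - p.2)%R))//.
have half s : measurable_fun (`]0%R, +oo[%classic : set B) (fun r : B =>
    \int[mu]_(t in `](- (pi / 2))%R, (pi / 2)%R[)
      (G (s * (r * cos t), s * (r * sin t))%R * r%:E)).
  have mdom : measurable (`]0%R, +oo[%classic : set B) by [].
  have marc : measurable (`](- (pi / 2))%R, (pi / 2)%R[%classic : set B) by [].
  have := @ge0_measurable_fun_integral _ _ B B R mu _ _
    (fun r t => G (s * (r * cos t), s * (r * sin t))%R * r%:E) mdom marc
    (measurable_funTS (mpol s)).
  apply => r t; rewrite /= in_itv/= andbT => r0 _.
  by rewrite mule_ge0// lee_fin ltW.
rewrite -ge0_integralD//; first last.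
- have := half (-1)%R; apply: eq_measurable_fun => r _.
  by apply: eq_integral => t _; rewrite !mulN1r.
- move=> r; rewrite /= in_itv/= andbT => r0.
  by apply: integral_ge0 => t _; rewrite mule_ge0// lee_fin ltW.
- have := half 1%R; apply: eq_measurable_fun => r _.
  by apply: eq_integral => t _; rewrite !mul1r.
- move=> r; rewrite /= in_itv/= andbT => r0.
  by apply: integral_ge0 => t _; rewrite mule_ge0// lee_fin ltW.
apply: eq_integral => r; rewrite inE/= in_itv/= andbT => r0.
rewrite [RHS]ge0_integral_circle_split//.
- by congr (_ + _); apply: eq_integral => t _; rewrite sinDpi cosDpi !mulrN.
- have := measurable_fun_pair2 r (mpol 1%R).
  by apply: eq_measurable_fun => t _; rewrite !mul1r.
- by move=> t; rewrite mule_ge0// lee_fin ltW.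
- by move=> t; rewrite sinD2pi cosD2pi.
Qed.

Lemma measurable_cylindrical :
  measurable_fun [set: B * B * B] (fun p : B * B * B => cylindrical p.1.1 p.2 p.1.2 : B * B * B).
Proof.
apply: measurable_fun_pair.
  apply: measurable_fun_pair; apply: measurable_funM => //.
  - exact: (measurableT_comp measurable_fst).
  - exact: (measurableT_comp (@measurable_cos R)).
  - exact: (measurableT_comp measurable_fst).
  - exact: (measurableT_comp (@measurable_sin R)).
exact: (measurableT_comp measurable_snd).
Qed.

Let area : set (B * B) -> \bar R := lebesgue2 R.

HB.instance Definition _ := Measure.on area.

(* The library only provides this instance for products of subprobabilities. *)
Let sigma_finite_area : sigma_finite setT area.
Proof.
have /sigma_finiteP[F [TF ndF Foo]] := sigma_finiteT mu.
exists (fun n => F n `*` F n); last first.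
  move=> k; have [mF Fk] := Foo k; split; first exact: measurableX.
  by rewrite [area _]product_measure1E// lte_mul_pinfty// ge0_fin_numE.
rewrite -setXTT TF predeqE => -[x y]; split.
  move=> [/= [n _ Fnx] [k _ Fky]]; exists (maxn n k) => //; split.
  - by move: x Fnx; exact/subsetPset/ndF/leq_maxl.
  - by move: y Fky; exact/subsetPset/ndF/leq_maxr.
by move=> [n _ []/= ? ?]; split; exists n.
Qed.

HB.instance Definition _ := Measure_isSigmaFinite.Build _ _ _ area sigma_finite_area.

Lemma ge0_integral_cylindrical (G : B * B * B -> \bar R) :
  measurable_fun setT G -> (forall p, 0 <= G p) ->
  \int[lebesgue3 R]_x G x =
  \int[lebesgue2 R]_(p in [set p | (0 < p.1)%R])
    \int[mu]_(t in `](- pi)%R, pi]) (G (cylindrical p.1 t p.2) * p.1%:E).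
Proof.
move=> mG G0.
have mH : measurable [set p : B * B | (0 < p.1)%R].
  rewrite (_ : [set p | _] = `]0%R, +oo[%classic `*` setT); first exact: measurableX.
  by apply/seteqP; split => -[r z]/=; rewrite in_itv/= andbT// => -[].
set H := [set p : B * B | (0 < p.1)%R] in mH *.
pose K (p : B * B) (t : B) := G (cylindrical p.1 t p.2) * p.1%:E.
have mK : measurable_fun setT (fun p : B * B * B => K p.1 p.2).
  apply: emeasurable_funM; first exact: (measurableT_comp mG measurable_cylindrical).
  by apply/measurable_EFinP; exact: (measurableT_comp measurable_fst).
have K0 p t : H p -> 0 <= K p t.
  by move=> /= p0; rewrite /K mule_ge0// lee_fin ltW.
pose I p := \int[mu]_(t in `](- pi)%R, pi]) K p t.
have marc : measurable (`](- pi)%R, pi]%classic : set B) by [].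
have mI : measurable_fun H I.
  apply: (@ge0_measurable_fun_integral _ _ (B * B)%type B R mu _ _ K mH marc (measurable_funTS mK)).
  by move=> p t Hp _; exact: K0.
have I0 p : 0 <= (I \_ H) p.
  rewrite patchE; case: ifPn => //; rewrite inE => Hp.
  by apply: integral_ge0 => t _; exact: K0.
have mIH : measurable_fun setT (I \_ H) by apply: (measurable_restrictT _ mH).1.
(* Both product measures are disintegrated with [z] outermost, so that the polar formula applies in
   each horizontal plane. *)
transitivity (\int[mu]_z \int[mu \x mu]_xy G (xy, z)).
  exact: (@fubini_tonelli2 _ _ (B * B)%type B R area mu G mG G0).
transitivity (\int[lebesgue2 R]_p (I \_ H) p); last by rewrite -integral_mkcond.
transitivity (\int[mu]_z \int[mu]_r (I \_ H) (r, z)); last first.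
  exact/esym/(@fubini_tonelli2 _ _ B B R mu mu (I \_ H) mIH I0).
apply: eq_integral => z _.
have mGz : measurable_fun setT (fun xy => G (xy, z)) by exact: measurable_fun_pair1.
rewrite ge0_integral_polar// integral_mkcond; apply: eq_integral => r _.
rewrite !patchE (_ : (r \in `]0%R, +oo[%classic) = ((r, z) \in H))//.
by apply/idP/idP; rewrite !inE/= in_itv/= andbT.
Qed.

End cylindrical_coordinates.

(** * Completeness of [L2] *)

Section convergence_of_fast_sequences.
Variable R : realType.

(** The constant 2 is a convenient bound for the exact [4 / 3]; the induction carries the stronger
    bound [2 * 4^-1 ^+ m - 2 * 4^-1 ^+ n]. *)
Lemma sum_geometric_half_le (m n : nat) : (m <= n)%N ->
  \sum_(m <= k < n) (4^-1 : R) ^+ k <= 2 * 4^-1 ^+ m.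
Proof.
move=> mn; apply: (@le_trans _ _ (2 * 4^-1 ^+ m - 2 * 4^-1 ^+ n)); last first.
  by rewrite gerBl mulr_ge0// exprn_ge0// invr_ge0.
rewrite -(subnKC mn); elim: (n - m)%N => [|k IH].
  by rewrite addn0 subrr big_geq.
rewrite addnS big_nat_recr ?leq_addr//= exprS.
have : 0 <= (4^-1 : R) ^+ (m + k) by rewrite exprn_ge0// invr_ge0.
move: IH; set s := \sum_(_ <= _ < _) _; set t := _ ^+ (m + k).
by move=> IH t0; lra.
Qed.

Lemma cvgn_fast (a : R^nat) (C : R) :
  (forall n, `|a n.+1 - a n| <= C * 2^-1 ^+ n) -> cvgn a.
Proof.
move=> aC; have C0 n : 0 <= C * 2^-1 ^+ n by exact: le_trans (aC n).
have : cvgn (series (telescope a)).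
  apply: normed_cvg; apply: series_le_cvg (C0) _ _ => //=.
  by apply: is_cvg_geometric_series; rewrite ger0_norm ?invr_ge0// invf_lt1// ltr1n.
move=> cs; rewrite (_ : a = fun n => a 0%N + series (telescope a) n).
  by apply: is_cvgD => //; exact: is_cvg_cst.
by apply/funext => n; exact: eq_sum_telescope.
Qed.

Lemma normc_Re_le (z : R[i]) : `|complex.Re z| <= normc z.
Proof.
rewrite -ler_sqr ?nnegrE ?normc_ge0// real_normK ?num_real// normc_sqr.
by rewrite lerDl sqr_ge0.
Qed.

Lemma normc_Im_le (z : R[i]) : `|complex.Im z| <= normc z.
Proof.
rewrite -ler_sqr ?nnegrE ?normc_ge0// real_normK ?num_real// normc_sqr.
by rewrite lerDr sqr_ge0.
Qed.

End convergence_of_fast_sequences.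

Section L2_completeness.
Context d (T : measurableType d) (R : realType).
Variables (mu : {measure set T -> \bar R}) (W : weighted_set T R).
Local Notation norm := (@L2fun_norm _ _ _ mu W).
Local Notation r := (4^-1 : R).

Lemma L2integral_norm (g : L2fun mu W) : L2integral mu W g = (norm g ^+ 2)%:E.
Proof.
rewrite sqr_sqrtr; last exact/fine_ge0/L2integral_ge0.
by rewrite (L2integral_fineK (L2fun_mem g)).
Qed.

Lemma L2fun_norm_ge0 (g : L2fun mu W) : 0 <= norm g.
Proof. exact: sqrtr_ge0. Qed.

Lemma L2fun_norm_fast (f : nat -> L2fun mu W) :
  (forall n, norm (f n.+1 - f n) <= r ^+ n) ->
  forall n m, (n <= m)%N -> norm (f m - f n) <= 2 * r ^+ n.
Proof.
move=> fr n m nm; apply: le_trans (sum_geometric_half_le R nm).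
rewrite -(subnKC nm); elim: (m - n)%N => [|k IH].
  rewrite addn0 subrr big_geq// -(scale0r (f n)) L2fun_normZ.
  by rewrite Normc.normc0 mul0r.
rewrite addnS big_nat_recr ?leq_addr//=.
have -> : f (n + k).+1 - f n = (f (n + k)%N - f n) + (f (n + k).+1 - f (n + k)%N).
  by rewrite [RHS]addrC addrA subrK.
exact: le_trans (L2fun_normD _ _) (lerD IH (fr _)).
Qed.

Section limit.
Variable f : nat -> L2fun mu W.
Hypothesis fr : forall n, norm (f n.+1 - f n) <= r ^+ n.

Let df n : L2fun mu W := f n.+1 - f n.

(* Where it is finite, [|f n.+1 x - f n x| = O(2 ^- n)]. *)
Let Phi x : \bar R :=
  (\sum_(n <oo) (4 ^+ n)%:E * sqnorm_density W (df n) x)%E.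

Let dens0 n x : wset W x ->
  (0 <= (4 ^+ n)%:E * sqnorm_density W (df n) x)%E.
Proof. by move=> Wx; rewrite mule_ge0 ?sqnorm_density_ge0// lee_fin exprn_ge0. Qed.

Let mdens n : measurable_fun W (fun x =>
  (4 ^+ n)%:E * sqnorm_density W (df n) x)%E.
Proof.
apply: measurable_funeM; apply: measurable_sqnorm_density.
exact: L2fun_measurable.
Qed.

Let mPhi : measurable_fun W Phi.
Proof. by apply: ge0_emeasurable_sum => // n x Wx _; exact: dens0. Qed.

(** The weight [4 ^+ n] against the squared step [(r ^+ n) ^+ 2] leaves [r ^+ n], which is still
    summable. *)
Let Phi_integral : (\int[mu]_(x in W) Phi x < +oo)%E.
Proof.
have mW := measurable_wset W.
rewrite /Phi integral_nneseries//.
apply: (@le_lt_trans _ _ 2%:E); last exact: ltry.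
apply: lime_le => [|]; first apply: is_cvg_nneseries => n _ _.
  by apply: integral_ge0 => x; exact: dens0.
apply: nearW => n; apply: (@le_trans _ _ (\sum_(0 <= k < n) (r ^+ k)%:E)%E).
  apply: lee_sum => k _; rewrite ge0_integralZl//; last 2 first.
  - by apply: measurable_sqnorm_density; exact: L2fun_measurable.
  - by move=> x; exact: sqnorm_density_ge0.
  rewrite -[X in (_ * X)%E]/(L2integral mu W _) L2integral_norm -EFinM lee_fin.
  apply: (@le_trans _ _ (4 ^+ k * (r ^+ k) ^+ 2)).
    rewrite ler_wpM2l ?exprn_ge0// ler_sqr ?nnegrE ?L2fun_norm_ge0 ?exprn_ge0 ?invr_ge0//.
    exact: fr.
  by rewrite expr2 mulrA -exprMn mulfV ?expr1n ?mul1r// pnatr_eq0.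
rewrite sumEFin lee_fin (le_trans (sum_geometric_half_le _ _))//.
by rewrite expr0 mulr1.
Qed.

Let A := wset W `&` Phi @^-1` [set y | (y < +oo)%E].

Let mA : measurable A.
Proof.
have := mPhi (measurable_wset W) (emeasurable_itv `]-oo, +oo%E[).
rewrite /A (_ : [set` `]-oo, +oo%E[] = [set y : \bar R | (y < +oo)%E])//.
Qed.

Let ae_A : {ae mu, forall x, wset W x -> A x}.
Proof.
have mW := measurable_wset W.
have iPhi : mu.-integrable W Phi.
  apply/integrableP; split => //.
  under eq_integral.
    move=> x /[!inE] Wx; rewrite gee0_abs; first over.
    by apply: nneseries_ge0 => n _ _; exact: dens0.
  exact: Phi_integral.
apply: filterS (integrable_ae mW iPhi) => x h Wx; split => //=.
by have := h Wx; rewrite fin_numElt => /andP[].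
Qed.

(** A single term of the series is at most [Phi x]. Dividing by [4 ^+ n] and by the weight, then
    taking square roots, yields the rate [2^-1 ^+ n] required by [cvgn_fast]. *)
Let step x : A x -> exists C, forall n, normc (f n.+1 x - f n x) <= C * 2^-1 ^+ n.
Proof.
move=> [Wx Ax]; have w0 := weight_gt0 Wx.
have Phi0 : (0 <= Phi x)%E by apply: nneseries_ge0 => n _ _; exact: dens0.
exists (Num.sqrt (fine (Phi x) / weight W x)) => n.
rewrite -ler_sqr ?nnegrE ?normc_ge0// ?mulr_ge0 ?sqrtr_ge0 ?exprn_ge0 ?invr_ge0//.
rewrite exprMn sqr_sqrtr ?divr_ge0 ?fine_ge0 ?(ltW w0)//.
rewrite -exprM mulnC exprM (_ : (2^-1 : R) ^+ 2 = r); last by field.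
rewrite mulrAC ler_pdivlMr// exprVn ler_pdivlMr ?exprn_gt0//.
rewrite -lee_fin fineK ?ge0_fin_numE// EFinM muleC.
rewrite -[X in (_ * X <= _)%E]/(sqnorm_density W (df n) x).
apply: le_trans (nneseries_lim_ge n.+1 _) => [|k *]; last exact: dens0.
rewrite big_nat_recr//= leeDr// big_seq sume_ge0// => k _; exact: dens0.
Qed.

(** The value 0 off [A] makes the real and imaginary parts extensions by zero of limits taken on
    [A], hence measurable. *)
Let g0 (x : T) : R[i] := if x \in A then
  limn (fun n => complex.Re (f n x)) +i* limn (fun n => complex.Im (f n x)) else 0.

Let Re_cvg x : A x -> complex.Re (f n x) @[n --> \oo] --> complex.Re (g0 x).
Proof.
move=> Ax; rewrite /g0 mem_set//=; have [C hC] := step Ax.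
apply: (@cvgn_fast _ _ C) => n; apply: le_trans (hC n).
by rewrite -raddfB normc_Re_le.
Qed.

Let Im_cvg x : A x -> complex.Im (f n x) @[n --> \oo] --> complex.Im (g0 x).
Proof.
move=> Ax; rewrite /g0 mem_set//=; have [C hC] := step Ax.
apply: (@cvgn_fast _ _ C) => n; apply: le_trans (hC n).
by rewrite -raddfB normc_Im_le.
Qed.

Let mg0 : measurable_cfun W g0.
Proof.
have AW : A `<=` wset W by move=> x [].
have mW := measurable_wset W.
have mf n := L2fun_measurable (f n).
have aux (F : R[i] -> R) : F 0 = 0 ->
    (forall n, measurable_fun W (fun x => F (f n x))) ->
    (forall x, A x -> F (f n x) @[n --> \oo] --> F (g0 x)) ->
    measurable_fun W (fun x => F (g0 x)).
  move=> F0 mF cF; apply: measurable_funTS.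
  rewrite (_ : (fun x => F (g0 x)) = (fun x => F (g0 x)) \_ A).
    apply/(measurable_restrictT _ mA).1.
    apply: (@measurable_fun_cvg _ _ _ _ (fun n x => F (f n x))) => // n.
    exact: measurable_funS (mF n).
  by apply/funext => x; rewrite patchE; case: ifPn => // xA; rewrite /g0 (negbTE xA).
split.
- by apply: aux => // n; exact: (mf n).1.
- by apply: aux => // n; exact: (mf n).2.
Qed.

(** Fatou's lemma for [f m - f n] as [m] grows: the densities converge on [A], hence almost
    everywhere, to the density of [g0 - f n], and their integrals are bounded by [(2 * r ^+ n) ^+ 2]
    once [n <= m]. *)
Let fg n : (L2integral mu W (fun x => g0 x - f n x)%R <= ((2 * r ^+ n) ^+ 2)%:E)%E.
Proof.
have mW := measurable_wset W.
pose F m x := sqnorm_density W (f m - f n)%R x.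
have mF m : measurable_fun W (F m).
  by apply: measurable_sqnorm_density; exact: L2fun_measurable.
have F0 m x : wset W x -> (0 <= F m x)%E by exact: sqnorm_density_ge0.
rewrite /L2integral (@ae_eq_integral _ _ _ mu W (fun x => limn_einf (F ^~ x)))//; last 3 first.
- apply: measurable_sqnorm_density; have := measurable_cfun_lin (-1) (L2fun_measurable (f n)) mg0.
  rewrite (_ : _ + _ = fun x => g0 x - f n x)//.
  by apply/funext => x; rewrite -[LHS]/(-1 * f n x + g0 x) mulN1r addrC.
- apply: measurableT_comp => //; apply: measurable_fun_limn_esup => m.
  exact: measurableT_comp.
- apply: filterS ae_A => x h Wx; have Ax := h Wx.
  have : (F m x @[m --> \oo] --> sqnorm_density W (fun x => g0 x - f n x)%R x)%classic.
    apply: cvg_EFin; first exact: nearW.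
    have cRe := Re_cvg Ax; have cIm := Im_cvg Ax.
    have hR : ((normc (f m x - f n x) ^+ 2 * weight W x)%R @[m --> \oo] -->
        (normc (g0 x - f n x) ^+ 2 * weight W x)%R)%classic.
      apply: cvgMl; rewrite normc_sqr; under eq_fun do rewrite normc_sqr.
      under eq_fun do rewrite !raddfB.
      rewrite !raddfB.
      by apply: cvgD; (under eq_fun do rewrite expr2); rewrite expr2;
        apply: cvgM; apply: cvgB => //; exact: cvg_cst.
    exact: hR.
  by move=> h'; rewrite is_cvg_limn_einfE; [exact/esym/cvg_lim|apply/cvg_ex; eexists; exact: h'].
apply: le_trans (fatou mu mW mF F0) _.
rewrite limn_einf_lim; apply: lime_le; first exact: is_cvg_einfs.
exists n => // m /= nm; apply: (@le_trans _ _ (L2integral mu W (f m - f n)%R)).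
  by apply: ereal_inf_lbound; exists m => //=.
rewrite L2integral_norm lee_fin ler_sqr ?nnegrE ?L2fun_norm_ge0//.
exact: L2fun_norm_fast.
Qed.

Lemma L2fun_complete_fast :
  exists g : L2fun mu W, forall n, norm (g - f n) <= 2 * r ^+ n.
Proof.
(* The bound [fg 0] places [g0 - f 0] in [L2mem]; the limit is recovered by adding [f 0] back inside
   [L2fun]. *)
have g0f0 : (fun x => g0 x - f 0%N x) \in L2mem mu W.
  apply/L2memP; split; last exact: le_lt_trans (fg 0) (ltry _).
  have := measurable_cfun_lin (-1) (L2fun_measurable (f 0%N)) mg0.
  rewrite (_ : _ + _ = fun x => g0 x - f 0%N x)//.
  by apply/funext => x; rewrite -[LHS]/(-1 * f 0%N x + g0 x) mulN1r addrC.
exists (L2Fun g0f0 + f 0%N) => n.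
rewrite -ler_sqr ?nnegrE ?L2fun_norm_ge0 ?mulr_ge0 ?exprn_ge0 ?invr_ge0//.
rewrite -lee_fin -L2integral_norm; apply: le_trans (fg n).
rewrite le_eqVlt; apply/orP; left; apply/eqP; congr (L2integral mu W _).
apply/funext => x.
by rewrite -[LHS]/(g0 x - f 0%N x + f 0%N x - f n x) subrK.
Qed.

End limit.
End L2_completeness.

(** * Fourier coefficients on the circle *)

Section trigonometric_uniqueness.
Variable R : realType.
Local Notation B := (measurableTypeR R).
Local Notation mu := (@lebesgue_measure R).
Local Notation D := (`]- pi, pi]%classic : set B).

(** The sharpening device of the Brosowski-Deutsch proof of the Stone-Weierstrass theorem.
    Bernoulli's inequality gives the lower bound [1 - (2 * x) ^+ n], which settles [x < 1/2]. For
    [x > 1/2], multiplying by [(1 + x ^+ n) ^+ (2 ^ n)], which is at least [(2 * x) ^+ n], gives a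
    product at most 1, whence the upper bound [(2 * x)^-1 ^+ n]. *)
Lemma cvg_indicator_sharpening (x : R) : 0 <= x <= 1 -> x != 2^-1 ->
  (fun n => (1 - x ^+ n) ^+ (2 ^ n)%N) @ \oo --> ((x < 2^-1)%R%:R : R).
Proof.
move=> /andP[x0 x1] xh.
have mu_pow n : (2 ^ n)%:R * x ^+ n = (2 * x) ^+ n by rewrite natrX exprMn.
have xn1 n : 0 <= x ^+ n <= 1 by rewrite exprn_ge0// exprn_ile1.
have le1 n : (1 - x ^+ n) ^+ (2 ^ n)%N <= 1.
  by have /andP[? ?] := xn1 n; rewrite exprn_ile1// ?subr_ge0// gerBl.
have ge0 n : 0 <= (1 - x ^+ n) ^+ (2 ^ n)%N.
  by have /andP[? ?] := xn1 n; rewrite exprn_ge0// subr_ge0.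
have bernoulli (u : R) m : -1 <= u -> 1 + m%:R * u <= (1 + u) ^+ m.
  move=> u1; elim: m => [|m IH]; first by rewrite mul0r addr0 expr0.
  have u1' : 0 <= 1 + u by rewrite -lerBlDl sub0r.
  rewrite exprS; apply: le_trans (ler_wpM2l u1' IH).
  rewrite -natr1; have : 0 <= m%:R * u ^+ 2 by rewrite mulr_ge0// sqr_ge0.
  rewrite expr2; set a := m%:R => h; nra.
case: ltP => xh'.
  apply: (@squeeze_cvgr _ _ _ _ (fun n => 1 - (2 * x) ^+ n) (cst 1)).
  - apply: nearW => n; rewrite le1 andbT -mu_pow -mulrN.
    by apply: bernoulli; rewrite lerN2; have /andP[] := xn1 n.
  - rewrite -[X in _ --> X]subr0; apply: cvgB; first exact: cvg_cst.
    apply: cvg_expr; rewrite ger0_norm ?mulr_ge0//.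
    by rewrite mulrC -ltr_pdivlMr// mul1r.
  - exact: cvg_cst.
have {xh xh'} xh : 2^-1 < x by rewrite lt_neqAle eq_sym xh.
apply: (@squeeze_cvgr _ _ _ _ (cst 0) (fun n => ((2 * x)^-1) ^+ n)).
- apply: nearW => n; rewrite ge0/= exprVn -[leRHS]div1r ler_pdivlMr; last first.
    by rewrite exprn_gt0// mulr_gt0// (lt_trans _ xh)// invr_gt0.
  have xn0 : 0 <= x ^+ n by have /andP[] := xn1 n.
  apply: (@le_trans _ _ ((1 - x ^+ n) ^+ (2 ^ n)%N * (1 + x ^+ n) ^+ (2 ^ n)%N)).
    rewrite ler_wpM2l// -mu_pow (le_trans _ (bernoulli _ _ _))//.
      by rewrite lerDr.
    by rewrite (le_trans _ xn0)// lerN10.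
  rewrite -exprMn -subr_sqr expr1n exprn_ile1//.
    by rewrite subr_ge0 exprn_ile1// ?sqr_ge0//; have /andP[] := xn1 n.
  by rewrite gerBl sqr_ge0.
- exact: cvg_cst.
- apply: cvg_expr; rewrite ger0_norm ?invr_ge0 ?mulr_ge0//.
  by rewrite invf_lt1 ?mulr_gt0 ?(lt_trans _ xh) ?invr_gt0// mulrC -ltr_pdivrMr// mul1r.
Qed.

Lemma integrable_mul_le1 (g u : B -> R) :
  mu.-integrable D (EFin \o g) -> measurable_fun D u -> (forall t, `|u t| <= 1) ->
  mu.-integrable D (EFin \o (fun t => g t * u t)).
Proof.
move=> ig mu' u1; apply: (le_integrable _ _ _ ig) => //.
  apply/measurable_EFinP/measurable_funM => //.
  by apply/measurable_EFinP; exact: (measurable_int _ ig).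
by move=> t _ /=; rewrite lee_fin normrM ler_piMr.
Qed.

Let mcos (k : R) : measurable_fun D (fun t => cos (k * t)).
Proof.
apply: measurable_funTS; apply: (measurableT_comp (@measurable_cos R)).
exact: measurable_funM.
Qed.

Let msin (k : R) : measurable_fun D (fun t => sin (k * t)).
Proof.
apply: measurable_funTS; apply: (measurableT_comp (@measurable_sin R)).
exact: measurable_funM.
Qed.

Let cos1 (t : R) : `|cos t| <= 1.
Proof. by rewrite ler_norml cos_geN1 cos_le1. Qed.

Let sin1 (t : R) : `|sin t| <= 1.
Proof. by rewrite ler_norml sin_geN1 sin_le1. Qed.

(** Frequencies range over [int] so that the shifts [k + 1] and [k - 1] of the product formulas need
    no special case at zero. *)
Definition trig_orthogonal (g : B -> R) :=
  mu.-integrable D (EFin \o g) /\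
  forall k : int, \int[mu]_(t in D) (g t * cos (k%:~R * t)) = 0 /\
                  \int[mu]_(t in D) (g t * sin (k%:~R * t)) = 0.

Lemma trig_orthogonalZ c g :
  trig_orthogonal g -> trig_orthogonal (fun t => g t * c).
Proof.
move=> [ig g0]; split=> [|k].
  rewrite (_ : _ \o _ = fun t => (EFin \o g) t * c%:E)%E//.
  exact: integrableZr.
have [gc gs] := g0 k; split.
- under eq_Rintegral do rewrite mulrAC.
  by rewrite RintegralZr ?gc ?mul0r//; exact: integrable_mul_le1.
- under eq_Rintegral do rewrite mulrAC.
  by rewrite RintegralZr ?gs ?mul0r//; exact: integrable_mul_le1.
Qed.

Lemma trig_orthogonalD g h : trig_orthogonal g -> trig_orthogonal h ->
  trig_orthogonal (fun t => g t + h t).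
Proof.
move=> [ig g0] [ih h0]; split=> [|k].
  rewrite (_ : _ \o _ = (EFin \o g) \+ (EFin \o h))%E//.
  exact: integrableD.
have [gc gs] := g0 k; have [hc hs] := h0 k; split.
- under eq_Rintegral do rewrite mulrDl.
  by rewrite RintegralD ?gc ?hc ?addr0//; exact: integrable_mul_le1.
- under eq_Rintegral do rewrite mulrDl.
  by rewrite RintegralD ?gs ?hs ?addr0//; exact: integrable_mul_le1.
Qed.

(* The multipliers form an algebra; this replaces an explicit description of the
   trigonometric polynomials. *)
Definition trig_multiplier (u : R -> R) :=
  forall g, trig_orthogonal g -> trig_orthogonal (fun t => g t * u t).

Lemma trig_multiplier_cst c : trig_multiplier (fun=> c).
Proof. by move=> g; exact: trig_orthogonalZ. Qed.

Lemma trig_multiplierD u v :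
  trig_multiplier u -> trig_multiplier v -> trig_multiplier (fun t => u t + v t).
Proof.
move=> mu' mv g g0; rewrite (_ : (fun t => _) = fun t => g t * u t + g t * v t).
  by apply: trig_orthogonalD; [exact: mu'|exact: mv].
by apply/funext => t; rewrite mulrDr.
Qed.

Lemma trig_multiplierM u v :
  trig_multiplier u -> trig_multiplier v -> trig_multiplier (fun t => u t * v t).
Proof.
move=> mu' mv g g0; rewrite (_ : (fun t => _) = fun t => g t * u t * v t).
  by apply: mv; exact: mu'.
by apply/funext => t; rewrite mulrA.
Qed.

Lemma trig_multiplierX u n : trig_multiplier u -> trig_multiplier (fun t => u t ^+ n).
Proof.
move=> mu'; elim: n => [|n IH]; first exact: trig_multiplier_cst.
under eq_fun do rewrite exprS.
exact: trig_multiplierM.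
Qed.

Let half_sum (g : B -> R) (u v : B -> R) : mu.-integrable D (EFin \o g) ->
  measurable_fun D u -> measurable_fun D v ->
  (forall t, `|u t| <= 1) -> (forall t, `|v t| <= 1) ->
  \int[mu]_(t in D) (g t * u t) = 0 -> \int[mu]_(t in D) (g t * v t) = 0 ->
  forall a b, \int[mu]_(t in D) (g t * ((a * u t + b * v t))) = 0.
Proof.
move=> ig mu' mv u1 v1 iu iv a b.
have igu := integrable_mul_le1 ig mu' u1.
have igv := integrable_mul_le1 ig mv v1.
transitivity (\int[mu]_(t in D) (g t * u t * a + g t * v t * b)).
  by apply: eq_Rintegral => t _; ring.
rewrite RintegralD//.
- by rewrite !RintegralZr// iu iv !mul0r addr0.
- by rewrite (_ : _ \o _ = fun t => (EFin \o (fun t => g t * u t)%R) t * a%:E)%E//;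
    exact: integrableZr.
- by rewrite (_ : _ \o _ = fun t => (EFin \o (fun t => g t * v t)%R) t * b%:E)%E//;
    exact: integrableZr.
Qed.

(** By the product-to-sum formulas, multiplication by the cosine only averages the frequencies
    [k + 1] and [k - 1]. *)
Lemma trig_multiplier_cos : trig_multiplier (@cos R).
Proof.
have mc : measurable_fun D (@cos R) by apply: measurable_funTS; exact: measurable_cos.
move=> g [ig g0]; split=> [|k]; first exact: integrable_mul_le1.
have [cp sp] := g0 (k + 1); have [cm sm] := g0 (k - 1).
have e t : (k + 1)%:~R * t = k%:~R * t + t :> R by rewrite rmorphD/= mulrDl mul1r.
have e' t : (k - 1)%:~R * t = k%:~R * t - t :> R by rewrite rmorphB/= mulrBl mul1r.
split.
- have /(_ 2^-1 2^-1) := half_sum ig (@mcos (k + 1)%:~R) (@mcos (k - 1)%:~R)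
    (fun=> cos1 _) (fun=> cos1 _) cp cm.
  move=> h; rewrite -[RHS]h; apply: eq_Rintegral => t _.
  by rewrite e e' cosD cosB; field.
- have /(_ 2^-1 2^-1) := half_sum ig (@msin (k + 1)%:~R) (@msin (k - 1)%:~R)
    (fun=> sin1 _) (fun=> sin1 _) sp sm.
  move=> h; rewrite -[RHS]h; apply: eq_Rintegral => t _.
  by rewrite e e' sinD sinB; field.
Qed.

Lemma trig_multiplier_sin : trig_multiplier (@sin R).
Proof.
have mc : measurable_fun D (@sin R) by apply: measurable_funTS; exact: measurable_sin.
move=> g [ig g0]; split=> [|k]; first exact: integrable_mul_le1.
have [cp sp] := g0 (k + 1); have [cm sm] := g0 (k - 1).
have e t : (k + 1)%:~R * t = k%:~R * t + t :> R by rewrite rmorphD/= mulrDl mul1r.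
have e' t : (k - 1)%:~R * t = k%:~R * t - t :> R by rewrite rmorphB/= mulrBl mul1r.
split.
- have /(_ 2^-1 (- 2^-1)) := half_sum ig (@msin (k + 1)%:~R) (@msin (k - 1)%:~R)
    (fun=> sin1 _) (fun=> sin1 _) sp sm.
  move=> h; rewrite -[RHS]h; apply: eq_Rintegral => t _.
  by rewrite e e' sinD sinB; field.
- have /(_ (- 2^-1) 2^-1) := half_sum ig (@mcos (k + 1)%:~R) (@mcos (k - 1)%:~R)
    (fun=> cos1 _) (fun=> cos1 _) cp cm.
  move=> h; rewrite -[RHS]h; apply: eq_Rintegral => t _.
  by rewrite e e' cosD cosB; field.
Qed.

Lemma trig_orthogonal_integral0 g : trig_orthogonal g -> \int[mu]_(t in D) g t = 0.
Proof.
move=> [_ /(_ 0)[+ _]] => g0; rewrite -[RHS]g0; apply: eq_Rintegral => t _.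
by rewrite mul0r cos0 mulr1.
Qed.

Lemma trig_orthogonal_itv g b : trig_orthogonal g -> - pi < b <= pi ->
  \int[mu]_(t in `]- pi, b]) g t = 0.
Proof.
move=> g0 /andP[pib bpi]; have [ig _] := g0.
(* [cos (t / 2) * sin ((b - t) / 2)] is a trigonometric polynomial in [t] and has
   the sign of [b - t] on [`]- pi, pi[]. *)
pose x (t : R) := (1 - cos (t / 2) * sin ((b - t) / 2)) / 2.
have xE t : x t = 2^-1 + (- 4^-1) * sin (b / 2) + (- 4^-1 * sin (b / 2)) * cos t
    + (4^-1 * cos (b / 2)) * sin t.
  rewrite /x (_ : (b - t) / 2 = b / 2 - t / 2) ?mulrBl// sinB.
  have -> : cos t = 2 * cos (t / 2) ^+ 2 - 1.
    by rewrite {1}(_ : t = t / 2 + t / 2) ?cosD -?expr2 ?sin2cos2//; field.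
  have -> : sin t = 2 * sin (t / 2) * cos (t / 2).
    by rewrite {1}(_ : t = t / 2 + t / 2) ?sinD; field.
  by field.
have mx : trig_multiplier x.
  have -> : x = fun t => 2^-1 + (- 4^-1) * sin (b / 2) + (- 4^-1 * sin (b / 2)) * cos t
    + (4^-1 * cos (b / 2)) * sin t by apply/funext.
  apply: trig_multiplierD; [apply: trig_multiplierD|].
  - exact: trig_multiplier_cst.
  - by apply: trig_multiplierM; [exact: trig_multiplier_cst|exact: trig_multiplier_cos].
  - by apply: trig_multiplierM; [exact: trig_multiplier_cst|exact: trig_multiplier_sin].
have x01 t : 0 <= x t <= 1.
  have : `|cos (t / 2) * sin ((b - t) / 2)| <= 1 by rewrite normrM mulr_ile1.
  by rewrite ler_norml => /andP[h1 h2]; apply/andP; split; rewrite /x; lra.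
have mxB : measurable_fun D x.
  apply: measurable_funM => //; apply: measurable_funB => //; apply: measurable_funM.
    apply: measurable_funTS; apply: (measurableT_comp (@measurable_cos R)).
    exact: measurable_funM.
  apply: measurable_funTS; apply: (measurableT_comp (@measurable_sin R)).
  by apply: measurable_funM => //; exact: measurable_funB.
pose y n t := (1 - x t ^+ n) ^+ (2 ^ n)%N.
have my n : measurable_fun D (y n).
  by apply: measurable_funX; apply: measurable_funB => //; exact: measurable_funX.
have y01 n t : `|y n t| <= 1.
  have /andP[x0 x1] := x01 t.
  by rewrite ger0_norm ?exprn_ge0 ?exprn_ile1 ?subr_ge0 ?exprn_ile1// gerBl exprn_ge0.
have iy n : \int[mu]_(t in D) (g t * y n t) = 0.
  apply: trig_orthogonal_integral0.
  have mult : trig_multiplier (y n).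
    apply: trig_multiplierX; apply: trig_multiplierD; first exact: trig_multiplier_cst.
    rewrite (_ : (fun t => - x t ^+ n) = fun t => -1 * x t ^+ n); last first.
      by apply/funext => t; rewrite mulN1r.
    apply: trig_multiplierM; first exact: trig_multiplier_cst.
    exact: trig_multiplierX.
  exact: mult.
have mg : measurable_fun D g by apply/measurable_EFinP; exact: (measurable_int _ ig).
(* At [t = b] the sine factor vanishes and at [t = pi] the cosine factor does, so [x t] is 1/2
   there, and the powers tend to neither 0 nor 1. These two points are negligible. *)
have cvy t : D t -> t != pi -> t != b -> y n t @[n --> \oo] --> ((t < b)%R%:R : R).
  rewrite /= in_itv/= => /andP[pit tpi] tnpi tnb.
  have {tpi tnpi}tpi : t < pi by rewrite lt_neqAle tnpi.
  have ct : 0 < cos (t / 2) by rewrite cos_gt0_pihalf//; lra.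
  have xb : (x t < 2^-1) = (t < b).
    have -> : (x t < 2^-1) = (0 < cos (t / 2) * sin ((b - t) / 2)) by apply/idP/idP; rewrite /x; lra.
    rewrite pmulr_rgt0//; apply/idP/idP => [|tb]; last by rewrite sin_gt0_pi//; lra.
    apply: contraTT; rewrite -!leNgt => bt.
    rewrite -oppr_ge0 -sinN sin_ge0_pi//; lra.
  rewrite -xb; apply: cvg_indicator_sharpening => //.
  apply/eqP => xh; move: tnb; rewrite neq_lt -xb => /orP[|bt]; first by rewrite xh ltxx.
  have : 0 < sin (- ((b - t) / 2)) by rewrite sin_gt0_pi//; lra.
  rewrite sinN => s0; have := mulr_gt0 ct s0; move: xh; rewrite /x; lra.
have mD : measurable D by [].
have ae_neq (c : R) : {ae mu, forall t, t != c}.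
  exists [set c]; split => //; first exact: lebesgue_measure_set1.
  by move=> t /= /negP; rewrite negbK => /eqP.
have mgy n : measurable_fun D (fun t => (g t * y n t)%:E).
  by apply/measurable_EFinP; exact: measurable_funM.
have mgb : measurable_fun D (fun t => (g t * (t < b)%R%:R)%:E).
  apply/measurable_EFinP/measurable_funM => //.
  rewrite (_ : (fun t => _) = \1_(`]-oo, b[%classic : set B)).
    exact/measurable_funTS/measurable_indic.
  apply/funext => t; rewrite indicE (_ : (t \in _) = (t < b))//.
  by apply/idP/idP; rewrite inE/= in_itv.
have cae : {ae mu, forall t, D t ->
    (fun n => (g t * y n t)%:E) @ \oo --> (g t * (t < b)%R%:R)%:E}.
  have aeF := ae_filter_ringOfSetsType mu.
  apply: filterS2 (ae_neq pi) (ae_neq b) => t tpi tb Dt.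
  apply: cvg_EFin; first exact: nearW.
  by apply: cvgMr; exact: cvy.
have ig' : mu.-integrable D (fun t => `|g t|%:E).
  by rewrite (_ : (fun t => _) = abse \o (EFin \o g))//; exact: integrable_abse.
have dom : {ae mu, forall t n, D t -> (`|(g t * y n t)%:E| <= `|g t|%:E)%E}.
  by apply: aeW => t /= n _; rewrite lee_fin normrM ler_piMr.
have [igb _] := dominated_convergence mD mgy mgb cae ig' dom.
rewrite (_ : [sequence _]_n = cst 0%E); last first.
  apply/funext => n /=; rewrite -[LHS]fineK; last first.
    apply: integrable_fin_num => //; exact: integrable_mul_le1.
  by congr EFin; exact: iy.
move=> /cvg_lim; rewrite lim_cst// => /(_ (@ereal_hausdorff R)) c.
rewrite -Rintegral_itv_bndo_bndc; last first.
  by apply: integrableS ig => // t; rewrite /= !in_itv/= => /andP[-> /ltW/le_trans]; apply.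
rewrite (_ : `]- pi, b[%classic = D `&` `]-oo, b[); last first.
  apply/seteqP; split=> t; rewrite /= !in_itv/=.
    by move=> /andP[-> tb]; split => //; exact: le_trans (ltW tb) bpi.
  by move=> [/andP[-> _] ->].
rewrite Rintegral_mkcondr /Rintegral.
rewrite (_ : \int[mu]_(x in D) _ = 0)%E// [RHS]c; apply: eq_integral => t _.
rewrite patchE (_ : (t \in _) = (t < b)); last first.
  by apply/idP/idP; rewrite inE/= in_itv.
by case: ifP => _; rewrite ?mulr1 ?mulr0.
Qed.

(** The primitive from [- pi] of [g] extended by zero vanishes on the whole line, and its derivative
    is [g] almost everywhere on the interval by Lebesgue differentiation. *)
Lemma trig_orthogonal_ae0 g : trig_orthogonal g -> {ae mu, forall t, D t -> g t = 0}.
Proof.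
move=> g0; have [ig _] := g0.
pose f := g \_ D.
have if_ : mu.-integrable setT (EFin \o f).
  rewrite (_ : _ \o _ = (EFin \o g) \_ D); last by rewrite restrict_EFin.
  by apply/integrable_restrict => //; rewrite setTI.
have fi (a : itv_bound R) y : mu.-integrable [set` Interval a (BRight y)] (EFin \o f).
  exact: integrableS if_.
have := @FTC1 _ f (BRight (- pi)) (fi _) (integrable_locally (measurable_itv _) ig).
set F := (fun x : R => \int[_]_(_ in _) _) => ftc.
have F0 x : F x = 0.
  rewrite /F /f -Rintegral_mkcondr.
  have [xpi|pix] := leP x (- pi).
    rewrite (_ : _ `&` _ = set0) ?Rintegral_set0// -subset0 => t [/=].
    by rewrite in_itv/= => /andP[/lt_le_trans/[apply]]; rewrite ltNge xpi.
  have [xpi'|pix'] := leP x pi.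
    rewrite (_ : _ `&` _ = `]- pi, x]%classic).
      by apply: trig_orthogonal_itv => //; rewrite pix.
    apply/seteqP; split=> t; rewrite /= !in_itv/=; first by case.
    by move=> /andP[-> tx]; rewrite tx (le_trans tx).
  rewrite (_ : _ `&` _ = D); first exact: trig_orthogonal_integral0.
  apply/seteqP; split=> t; rewrite /= !in_itv/=; first by case.
  by move=> /andP[-> tpi]; rewrite tpi (le_trans tpi (ltW pix')).
have aeF := ae_filter_ringOfSetsType mu.
apply: filterS ftc => t h; rewrite /= in_itv/= => /andP[pit tpi].
have [_] := h pit; rewrite /f patchE mem_set/= ?in_itv/= ?pit// => <-.
rewrite (_ : F = cst 0); first by rewrite derive1_cst.
exact/funext.
Qed.

End trigonometric_uniqueness.

(** * Complex Fourier coefficients of a square integrable function on a circle *)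

Section circle_Fourier_coefficients.
Variable R : realType.
Local Notation B := (measurableTypeR R).
Local Notation mu := (@lebesgue_measure R).
Local Notation D := (`]- pi, pi]%classic : set B).
Implicit Types (h : B -> R[i]) (c : R[i]) (k : int).

Lemma Re_mul (z w : R[i]) : complex.Re (z * w) =
  complex.Re z * complex.Re w - complex.Im z * complex.Im w.
Proof. by case: z w => [? ?] [? ?]. Qed.

Lemma Im_mul (z w : R[i]) : complex.Im (z * w) =
  complex.Re z * complex.Im w + complex.Im z * complex.Re w.
Proof. by case: z w => [? ?] [? ?]. Qed.

(** The expansion is affine in the real and imaginary parts of [z] apart from [normc z ^+ 2], so it
    can be integrated term by term over the reals. *)
Lemma normc_sqr_sub_scale (z c : R[i]) (s : R) :
  normc (z - c * s%:C) ^+ 2 = normc z ^+ 2 + (- (2 * s * complex.Re c) * complex.Re z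
    + (- (2 * s * complex.Im c) * complex.Im z + s ^+ 2 * normc c ^+ 2)).
Proof. by rewrite !normc_sqr; case: z c => [? ?] [? ?] /=; ring. Qed.

Lemma normc_expi (t : R) : normc (expi t) = 1.
Proof. by rewrite /normc /= cos2Dsin2 sqrtr1. Qed.

Lemma expiN_mul (t : R) : expi t * expi (- t) = 1.
Proof.
apply/eqP; rewrite eq_complex /= cosN sinN mulrN opprK -!expr2 cos2Dsin2.
by rewrite mulrN [sin t * _]mulrC addNr !eqxx.
Qed.

Lemma cintegrable_cst_mul c h : cintegrable h -> cintegrable (fun t => c * h t).
Proof.
move=> [ir ii]; have mD : measurable D by [].
split.
- rewrite (_ : _ \o _ = fun t => (complex.Re c)%:E * (EFin \o (fun t => complex.Re (h t))) t
    - (complex.Im c)%:E * (EFin \o (fun t => complex.Im (h t))) t)%E; last first.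
    by apply/funext => t; rewrite /= Re_mul EFinB !EFinM.
  by apply: integrableB => //; exact: integrableZl.
- rewrite (_ : _ \o _ = fun t => (complex.Re c)%:E * (EFin \o (fun t => complex.Im (h t))) t
    + (complex.Im c)%:E * (EFin \o (fun t => complex.Re (h t))) t)%E; last first.
    by apply/funext => t; rewrite /= Im_mul EFinD !EFinM.
  by apply: integrableD => //; exact: integrableZl.
Qed.

Lemma integrable_mulr_cst (a : R) (f : B -> R) :
  mu.-integrable D (EFin \o f) -> mu.-integrable D (EFin \o (fun t => a * f t)).
Proof.
move=> fi; rewrite (_ : _ \o _ = fun t => (a%:E * (EFin \o f) t)%E)//.
exact: integrableZl.
Qed.

Lemma integrable_add (f g : B -> R) :
  mu.-integrable D (EFin \o f) -> mu.-integrable D (EFin \o g) ->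
  mu.-integrable D (EFin \o (fun t => f t + g t)).
Proof.
move=> fi gi; rewrite (_ : _ \o _ = (EFin \o f) \+ (EFin \o g))%E//.
exact: integrableD.
Qed.

Lemma lebesgue_measure_circle : mu D = (2 * pi)%:E.
Proof.
have pi0 := @pi_gt0 R; rewrite /= lebesgue_measure_itv/= lte_fin ifT; last by lra.
by rewrite -EFinD; congr EFin; ring.
Qed.

Lemma integrable_circle_cst (a : R) : mu.-integrable D (EFin \o (fun=> a)).
Proof.
apply/integrableP; split; first exact: measurable_cst.
rewrite (eq_integral (fun=> `|a|%:E))//.
by rewrite integral_cst//= lebesgue_measure_circle -EFinM ltry.
Qed.

Lemma cintegral_cst_mul c h : cintegrable h ->
  cintegral (fun t => c * h t) = c * cintegral h.
Proof.
move=> [ir ii]; apply/eqP; rewrite eq_complex Re_mul Im_mul /=; apply/andP; split; apply/eqP.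
- under eq_Rintegral do rewrite Re_mul.
  by rewrite RintegralB ?RintegralZl//; exact: integrable_mulr_cst.
- under eq_Rintegral do rewrite Im_mul.
  by rewrite RintegralD ?RintegralZl//; exact: integrable_mulr_cst.
Qed.

Lemma cintegralD h g : cintegrable h -> cintegrable g ->
  cintegral (fun t => h t + g t) = cintegral h + cintegral g.
Proof.
move=> [hr hi] [gr gi]; apply/eqP; rewrite eq_complex /=; apply/andP; split; apply/eqP.
- by under eq_Rintegral do rewrite raddfD; rewrite RintegralD.
- by under eq_Rintegral do rewrite raddfD; rewrite RintegralD.
Qed.

Definition circle_coef h k : R[i] :=
  ((Num.sqrt (2 * pi))^-1)%:C * cintegral (fun t => h t * expi (- (k%:~R * t))).

Definition circle_basis k (t : R) : R[i] :=
  ((Num.sqrt (2 * pi))^-1)%:C * expi (k%:~R * t).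

Definition circle_L2 h :=
  [/\ measurable_fun D (fun t => complex.Re (h t)),
      measurable_fun D (fun t => complex.Im (h t)) &
      (\int[mu]_(t in D) (normc (h t) ^+ 2)%:E < +oo)%E].

Lemma sqr_circle_scale :
  (Num.sqrt (2 * pi : R))^-1 ^+ 2 * (2 * pi) = 1.
Proof.
have pi0 := @pi_gt0 R.
by rewrite exprVn sqr_sqrtr ?mulr_ge0 ?ltW// mulVf// mulf_neq0 ?gt_eqF.
Qed.

Lemma circle_L2_integrable h : circle_L2 h ->
  mu.-integrable D (EFin \o (fun t => normc (h t) ^+ 2)).
Proof.
move=> [mr mi hoo].
have mN : measurable_fun D (fun t => normc (h t) ^+ 2).
  rewrite (_ : (fun t => _) = fun t => complex.Re (h t) ^+ 2 + complex.Im (h t) ^+ 2).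
    by apply: measurable_funD; exact: measurable_funX.
  by apply/funext => t; rewrite normc_sqr.
apply/integrableP; split; first exact/measurable_EFinP.
by under eq_integral do rewrite gee0_abs ?lee_fin ?sqr_ge0//.
Qed.

(** The circle has finite measure, so square integrability implies integrability, through the bound
    [1 + normc z ^+ 2] for [normc z]. *)
Lemma circle_L2_cintegrable h k : circle_L2 h ->
  cintegrable (fun t => h t * expi (- (k%:~R * t))).
Proof.
move=> hL; have := circle_L2_integrable hL; have [mr mi _] := hL => iN.
have mc : measurable_fun D (fun t => cos (- (k%:~R * t))).
  apply: measurable_funTS; apply: (measurableT_comp (@measurable_cos R)).
  by apply: measurable_funN; exact: measurable_funM.
have ms : measurable_fun D (fun t => sin (- (k%:~R * t))).
  apply: measurable_funTS; apply: (measurableT_comp (@measurable_sin R)).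
  by apply: measurable_funN; exact: measurable_funM.
have i1 : mu.-integrable D (EFin \o (fun t => 1 + normc (h t) ^+ 2)).
  by apply: integrable_add => //; exact: integrable_circle_cst.
have bound (z w : R[i]) : normc w = 1 -> normc (z * w) <= `|1 + normc z ^+ 2|.
  move=> w1; rewrite normcZ w1 mulr1 ger0_norm ?addr_ge0 ?sqr_ge0//.
  have := sqr_ge0 (normc z - 1); rewrite sqrrB1; have := sqr_ge0 (normc z).
  by rewrite expr2 mulr2n => ? ?; lra.
split; apply: (le_integrable _ _ _ i1) => //.
- apply/measurable_EFinP.
  rewrite (_ : (fun t => _) = fun t => complex.Re (h t) * cos (- (k%:~R * t))
    - complex.Im (h t) * sin (- (k%:~R * t))); last by apply/funext => t; rewrite Re_mul.
  by apply: measurable_funB; exact: measurable_funM.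
- move=> t _; rewrite /= lee_fin.
  by apply: le_trans (normc_Re_le _) _; exact/bound/normc_expi.
- apply/measurable_EFinP.
  rewrite (_ : (fun t => _) = fun t => complex.Re (h t) * sin (- (k%:~R * t))
    + complex.Im (h t) * cos (- (k%:~R * t))); last by apply/funext => t; rewrite Im_mul.
  by apply: measurable_funD; exact: measurable_funM.
- move=> t _; rewrite /= lee_fin.
  by apply: le_trans (normc_Im_le _) _; exact/bound/normc_expi.
Qed.

Lemma circle_coef_lin c h g k : circle_L2 h -> circle_L2 g ->
  circle_coef (fun t => c * h t + g t) k = c * circle_coef h k + circle_coef g k.
Proof.
move=> /(circle_L2_cintegrable k) hi /(circle_L2_cintegrable k) gi.
rewrite /circle_coef mulrCA -mulrDr -(cintegral_cst_mul c hi).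
rewrite -(cintegralD (cintegrable_cst_mul c hi) gi).
by congr (_ * cintegral _); apply/funext => t; rewrite mulrDl mulrA.
Qed.

(** Multiplication by [expi (- (k%:~R * t))] preserves the modulus and turns the basis function into
    the constant [s]. After expansion, the linear terms integrate to the parts of the coefficient
    and the constant term to [normc c ^+ 2], because [s ^+ 2 * (2 * pi) = 1]. *)
Lemma circle_bessel h k c : circle_L2 h ->
  (\int[mu]_(t in D) (normc (h t - c * circle_basis k t) ^+ 2)%:E
     + (normc (circle_coef h k) ^+ 2)%:E =
   \int[mu]_(t in D) (normc (h t) ^+ 2)%:E
     + (normc (circle_coef h k - c) ^+ 2)%:E)%E.
Proof.
move=> hL; have iN := circle_L2_integrable hL.
have [iP iQ] := circle_L2_cintegrable k hL.
set H := fun t => h t * expi (- (k%:~R * t)).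
rewrite -/H in iP iQ; set s := (Num.sqrt (2 * pi))^-1 : R.
have s2 : s ^+ 2 * (2 * pi) = 1 := sqr_circle_scale.
pose N t := normc (h t) ^+ 2.
pose P t := complex.Re (H t); pose Q t := complex.Im (H t).
pose a := - (2 * s * complex.Re c); pose b := - (2 * s * complex.Im c).
pose e := s ^+ 2 * normc c ^+ 2.
have expand t : normc (h t - c * circle_basis k t) ^+ 2 =
    N t + (a * P t + (b * Q t + e)).
  have -> : normc (h t - c * circle_basis k t) = normc (H t - c * s%:C).
    rewrite -[LHS]mulr1 -(normc_expi (- (k%:~R * t))) -normcZ mulrBl -/(H t).
    congr (normc (_ - _)); rewrite /circle_basis -!mulrA expiN_mul mulr1//.
  have -> : N t = normc (H t) ^+ 2 by rewrite /H normcZ normc_expi mulr1.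
  exact: normc_sqr_sub_scale.
have ie := integrable_circle_cst e.
have ib : mu.-integrable D (EFin \o (fun t => b * Q t + e)).
  by apply: integrable_add => //; exact: integrable_mulr_cst.
have iab : mu.-integrable D (EFin \o (fun t => a * P t + (b * Q t + e))).
  by apply: integrable_add => //; exact: integrable_mulr_cst.
have toR (f : B -> R) : mu.-integrable D (EFin \o f) ->
    (\int[mu]_(t in D) (f t)%:E = (\int[mu]_(t in D) f t)%R%:E)%E.
  by move=> fi; rewrite fineK//; exact: integrable_fin_num.
under eq_integral do rewrite expand.
rewrite !toR//; last exact: integrable_add.
rewrite -!EFinD; congr EFin.
rewrite RintegralD// RintegralD//; last exact: integrable_mulr_cst.
rewrite RintegralD//; last exact: integrable_mulr_cst.
rewrite Rintegral_cst// [X in fine X]lebesgue_measure_circle [fine _]/= !RintegralZl//.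
rewrite /circle_coef -/s -/H /cintegral.
set p := \int[mu]_(t in D) P t; set q := \int[mu]_(t in D) Q t.
rewrite -[X in s%:C * X]/(p +i* q) (_ : s%:C * (p +i* q) = (s * p) +i* (s * q)); last first.
  by apply/eqP; rewrite eq_complex /= !mul0r subr0 addr0 !eqxx.
rewrite /e /a /b !normc_sqr /= !raddfB /=.
set n := \int[mu]_(t in D) N t.
transitivity (n + (- (2 * s * complex.Re c) * p + (- (2 * s * complex.Im c) * q +
   (s ^+ 2 * (2 * pi)) * (complex.Re c ^+ 2 + complex.Im c ^+ 2))) +
   ((s * p) ^+ 2 + (s * q) ^+ 2)); first by ring.
by rewrite s2; ring.
Qed.

Lemma continuous_FTC2_everywhere (f F : R -> R) (a b : R) : a < b ->
  continuous f -> (forall x : R, is_derive x (1 : R) F (f x)) ->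
  \int[mu]_(t in `]a, b]) f t = F b - F a.
Proof.
move=> ab cf dF; have mf : measurable_fun [set: B] f by exact: continuous_measurable_fun.
have cF : continuous F.
  by move=> x; apply: differentiable_continuous; apply/derivable1_diffP; apply: ex_derive.
rewrite /Rintegral integral_itv_obnd_cbnd; last exact/measurable_EFinP/measurable_funTS.
rewrite (@continuous_FTC2 _ f F)//.
- exact: continuous_subspaceT.
- split => [x _||].
  + exact: ex_derive.
  + by apply: cvg_at_right_filter; exact: cF.
  + by apply: cvg_at_left_filter; exact: cF.
- by move=> x _; rewrite derive1E; exact: derive_val.
Qed.

Lemma sin_intmul_pi (m : int) : sin (m%:~R * pi) = 0 :> R.
Proof.
have nat n : sin (n%:R * pi) = 0 :> R.
  elim: n => [|n IH]; first by rewrite mul0r sin0.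
  by rewrite -natr1 mulrDl mul1r sinDpi IH oppr0.
case: m => n; first exact: nat.
by rewrite NegzE rmorphN mulNr sinN nat oppr0.
Qed.

Let is_derive_scale (a x : R) : is_derive x (1 : R) (fun t : R => a * t) a.
Proof.
have h : is_derive x (1 : R) (a \*: (@id R)) (a *: (1 : R)) by exact: is_deriveZ.
by apply: is_derive_eq h _; rewrite [_ *: _]mulr1.
Qed.

Let is_derive_comp_scale (F : R -> R) (a x l : R) : is_derive (a * x) (1 : R) F l ->
  is_derive x (1 : R) (fun t => F (a * t)) (l * a).
Proof. by move=> h; exact: (@is_derive1_comp _ F (fun t => a * t)). Qed.

Lemma Rintegral_cos_int (m : int) : m != 0 ->
  \int[mu]_(t in D) cos (m%:~R * t) = 0 :> R.
Proof.
move=> m0; have m0' : m%:~R != 0 :> R by rewrite intr_eq0.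
have ab : - pi < pi :> R by have := @pi_gt0 R; lra.
have cf : continuous (fun t : R => cos (m%:~R * t)).
  move=> x; apply: continuous_comp; first exact: mulrl_continuous.
  exact: continuous_cos.
have dF (x : R) : is_derive x (1 : R) (fun t => m%:~R^-1 * sin (m%:~R * t)) (cos (m%:~R * x)).
  have h := is_derive_comp_scale (is_derive_sin (m%:~R * x)).
  have h' : is_derive x (1 : R) (m%:~R^-1 \*: (fun t => sin (m%:~R * t)))
    (m%:~R^-1 *: (cos (m%:~R * x) * m%:~R)) by exact: is_deriveZ.
  by apply: is_derive_eq h' _; rewrite [_ *: _]mulrCA mulVf// mulr1.
have -> := continuous_FTC2_everywhere ab cf dF.
by rewrite mulrN sinN sin_intmul_pi oppr0 !mulr0 subr0.
Qed.

Lemma Rintegral_sin_int (m : int) : \int[mu]_(t in D) sin (m%:~R * t) = 0 :> R.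
Proof.
have [->|m0] := eqVneq m 0.
  under eq_Rintegral do rewrite mul0r sin0.
  by rewrite Rintegral_cst// mul0r.
have m0' : m%:~R != 0 :> R by rewrite intr_eq0.
have ab : - pi < pi :> R by have := @pi_gt0 R; lra.
have cf : continuous (fun t : R => sin (m%:~R * t)).
  move=> x; apply: continuous_comp; first exact: mulrl_continuous.
  exact: continuous_sin.
have dF (x : R) : is_derive x (1 : R) (fun t => - m%:~R^-1 * cos (m%:~R * t)) (sin (m%:~R * x)).
  have h := is_derive_comp_scale (is_derive_cos (m%:~R * x)).
  have h' : is_derive x (1 : R) ((- m%:~R^-1) \*: (fun t => cos (m%:~R * t)))
    ((- m%:~R^-1) *: (- sin (m%:~R * x) * m%:~R)) by exact: is_deriveZ.
  by apply: is_derive_eq h' _; rewrite [_ *: _]mulrCA [- _^-1 * _]mulNr mulVf// mulrN1 opprK.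
have -> := continuous_FTC2_everywhere ab cf dF.
by rewrite mulrN cosN subrr.
Qed.

Lemma expiD (s t : R) : expi (s + t) = expi s * expi t.
Proof.
apply/eqP; rewrite eq_complex /= cosD sinD eqxx/=; apply/eqP; ring.
Qed.

Lemma cintegrable_expi (m : int) : cintegrable (fun t : R => expi (m%:~R * t)).
Proof.
split.
- rewrite (_ : _ \o _ = EFin \o (fun t => 1 * cos (m%:~R * t))); last first.
    by apply/funext => t; rewrite /= mul1r.
  apply: integrable_mul_le1; first exact: integrable_circle_cst.
    apply: measurable_funTS; apply: (measurableT_comp (@measurable_cos R)).
    exact: measurable_funM.
  by move=> t; rewrite ler_norml cos_geN1 cos_le1.
- rewrite (_ : _ \o _ = EFin \o (fun t => 1 * sin (m%:~R * t))); last first.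
    by apply/funext => t; rewrite /= mul1r.
  apply: integrable_mul_le1; first exact: integrable_circle_cst.
    apply: measurable_funTS; apply: (measurableT_comp (@measurable_sin R)).
    exact: measurable_funM.
  by move=> t; rewrite ler_norml sin_geN1 sin_le1.
Qed.

Lemma cintegral_expi (m : int) :
  cintegral (fun t : R => expi (m%:~R * t)) = if m == 0 then (2 * pi : R)%:C else 0.
Proof.
rewrite /cintegral /= Rintegral_sin_int; case: eqVneq => [->|m0].
  under eq_Rintegral do rewrite mul0r cos0.
  by rewrite Rintegral_cst//= [X in fine X]lebesgue_measure_circle/= mul1r.
by rewrite Rintegral_cos_int.
Qed.

Lemma circle_coef_basis c k j :
  circle_coef (fun t => c * circle_basis k t) j = if j == k then c else 0.
Proof.
rewrite /circle_coef /circle_basis; set s := (Num.sqrt (2 * pi))^-1 : R.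
transitivity (s%:C * cintegral (fun t => c * s%:C * expi ((k - j)%:~R * t))).
  congr (_ * cintegral _); apply/funext => t.
  by rewrite -!mulrA -expiD -mulrBl rmorphB.
rewrite cintegral_cst_mul; last exact: cintegrable_expi.
rewrite cintegral_expi subr_eq0 eq_sym; case: eqP => _; last by rewrite !mulr0.
have -> : s%:C * (c * s%:C * (2 * pi)%:C) = c * (s ^+ 2 * (2 * pi))%:C.
  by rewrite expr2 !(rmorphM (real_complex R))/=; ring.
by rewrite sqr_circle_scale mulr1.
Qed.

Lemma circle_coef_ae0 h : circle_L2 h -> (forall k, circle_coef h k = 0) ->
  {ae mu, forall t, D t -> h t = 0}.
Proof.
move=> hL h0.
have mD : measurable D by [].
have [ihr ihi] : cintegrable h.
  have := circle_L2_cintegrable 0 hL.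
  by rewrite (_ : (fun t => _) = h)//; apply/funext => t; rewrite mul0r oppr0 /expi cos0 sin0 mulr1.
have s0 : ((Num.sqrt (2 * pi : R))^-1)%:C != 0 :> R[i].
  by rewrite eq_complex /= negb_and gt_eqF// invr_gt0 sqrtr_gt0 mulr_gt0// pi_gt0.
have hk k : cintegral (fun t => h t * expi (- (k%:~R * t))) = 0.
  by have /eqP := h0 k; rewrite mulf_eq0 (negbTE s0) => /eqP.
pose u t := complex.Re (h t); pose v t := complex.Im (h t).
have mc k : measurable_fun D (fun t => cos (k%:~R * t) : R).
  apply: measurable_funTS; apply: (measurableT_comp (@measurable_cos R)).
  exact: measurable_funM.
have ms k : measurable_fun D (fun t => sin (k%:~R * t) : R).
  apply: measurable_funTS; apply: (measurableT_comp (@measurable_sin R)).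
  exact: measurable_funM.
have c1 k (t : R) : `|cos (k%:~R * t)| <= 1 by rewrite ler_norml cos_geN1 cos_le1.
have s1 k (t : R) : `|sin (k%:~R * t)| <= 1 by rewrite ler_norml sin_geN1 sin_le1.
have re0 k : \int[mu]_(t in D) (u t * cos (k%:~R * t)) +
             \int[mu]_(t in D) (v t * sin (k%:~R * t)) = 0.
  rewrite -RintegralD//; [|exact: integrable_mul_le1..].
  have /eqP := hk k; rewrite eq_complex => /andP[/eqP + _] => /= <-.
  by apply: eq_Rintegral => t _; rewrite Re_mul /= cosN sinN mulrN opprK.
have im0 k : \int[mu]_(t in D) (v t * cos (k%:~R * t)) -
             \int[mu]_(t in D) (u t * sin (k%:~R * t)) = 0.
  rewrite -RintegralB//; [|exact: integrable_mul_le1..].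
  have /eqP := hk k; rewrite eq_complex => /andP[_ /eqP] /= <-.
  by apply: eq_Rintegral => t _; rewrite Im_mul /= cosN sinN mulrN addrC.
have cosN_int (w : B -> R) k : \int[mu]_(t in D) (w t * cos ((- k)%:~R * t)) =
    \int[mu]_(t in D) (w t * cos (k%:~R * t)).
  by apply: eq_Rintegral => t _; rewrite rmorphN mulNr cosN.
have sinN_int (w : B -> R) k : mu.-integrable D (EFin \o w) ->
    \int[mu]_(t in D) (w t * sin ((- k)%:~R * t)) =
    - \int[mu]_(t in D) (w t * sin (k%:~R * t)).
  move=> wi; rewrite -[RHS]mulN1r -RintegralZl//; last exact: integrable_mul_le1.
  by apply: eq_Rintegral => t _; rewrite rmorphN mulNr sinN mulrN mulN1r.
(* The equations at [k] mix the integrals of [u] and [v]. Those at [- k] change the sign of the sine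
   integrals, and the four together force each integral to vanish. *)
have ou : trig_orthogonal u.
  split=> // k; have := re0 k; have := re0 (- k); have := im0 k; have := im0 (- k).
  by rewrite !cosN_int !sinN_int//; split; lra.
have ov : trig_orthogonal v.
  split=> // k; have := re0 k; have := re0 (- k); have := im0 k; have := im0 (- k).
  by rewrite !cosN_int !sinN_int//; split; lra.
have aeF := ae_filter_ringOfSetsType mu.
apply: filterS2 (trig_orthogonal_ae0 ou) (trig_orthogonal_ae0 ov) => t u0 v0 Dt.
by apply/eqP; rewrite eq_complex /= -/(u t) -/(v t) u0// v0// eqxx.
Qed.

End circle_Fourier_coefficients.

(** * Coordinates in a complete normed space *)

Section coordinate_isometry.
Variables (R : realType) (I : choiceType) (H K : normedModType R[i]).
Variables (F : I -> H -> K) (L : I -> K -> H).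

Local Notation "''N' x" := (complex.Re `|x|) (at level 10, x at level 8).
Local Notation r := (4^-1 : R).

Hypothesis F_linear : forall k, linear (F k).
Hypothesis pythagoras : forall k q v,
  'N (q - L k v) ^+ 2 + 'N (F k q) ^+ 2 = 'N q ^+ 2 + 'N (F k q - v) ^+ 2.
Hypothesis biorthogonal : forall j k v, F j (L k v) = if j == k then v else 0.
Hypothesis total : forall q, (forall k, F k q = 0) -> q = 0.
Hypothesis complete : forall u : nat -> H,
  (forall n, 'N (u n.+1 - u n) <= r ^+ n) ->
  exists l, forall n, 'N (l - u n) <= 2 * r ^+ n.

Lemma geometric_le0 (x C : R) : (forall n, x <= C * r ^+ n) -> x <= 0.
Proof.
move=> xC; have cC : C * r ^+ n @[n --> \oo] --> 0.
  by apply: cvg_geometric; rewrite ger0_norm ?invr_ge0// invf_lt1// ltr1n.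
by rewrite -(cvg_lim _ cC)//; apply: limr_ge; [apply/cvg_ex; exists 0|exact: nearW].
Qed.

Let N0 (V : normedModType R[i]) (x : V) : 0 <= 'N x.
Proof. by have := normr_ge0 x; rewrite lecE => /andP[]. Qed.

Let N_eq0 (V : normedModType R[i]) (x : V) : 'N x <= 0 -> x = 0.
Proof.
move=> x0; apply/normr0_eq0; have := normr_ge0 x; rewrite lecE => /andP[/eqP im0 x0'].
have /eqP re0 : 'N x == 0 by rewrite eq_le x0 x0'.
by case: `|x| im0 re0 => a b /= -> ->.
Qed.

Let ND (V : normedModType R[i]) (x y : V) : 'N (x + y) <= 'N x + 'N y.
Proof.
have := ler_normD x y; rewrite lecE => /andP[_].
by case: `|x| `|y| => [? ?] [? ?].
Qed.

HB.instance Definition _ k := GRing.isLinear.Build _ _ _ _ (F k) (F_linear k).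

Let F_contraction k q : 'N (F k q) <= 'N q.
Proof.
have := pythagoras k q (F k q); rewrite subrr normr0 expr0n addr0 => h.
by rewrite -ler_sqr ?nnegrE// -h lerDr sqr_ge0.
Qed.

Let S (s : seq I) (v : I -> K) : H := \sum_(k <- s) L k (v k).
Let T (s : seq I) (v : I -> K) : R := \sum_(k <- s) 'N (v k) ^+ 2.

Let F_S j s v : uniq s -> F j (S s v) = if j \in s then v j else 0.
Proof.
rewrite /S raddf_sum; elim: s => [|k s IH] /=; first by rewrite big_nil.
move=> /andP[ks us]; rewrite big_cons IH// biorthogonal in_cons.
case: eqVneq => [->|_] /=; first by rewrite (negbTE ks) addr0.
by rewrite add0r.
Qed.

(** The residual still has [F k q] as its coordinate at a new index [k], since the terms already
    subtracted are biorthogonal to it; [pythagoras] with [v := F k q] then removes one more term. *)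
Let bessel s q : uniq s ->
  'N (q - S s (F ^~ q)) ^+ 2 + T s (F ^~ q) = 'N q ^+ 2.
Proof.
rewrite /T; elim: s => [|k s IH] /=; first by rewrite /S !big_nil subr0 addr0.
move=> /andP[ks us]; rewrite /S !big_cons -/(S s _).
have Fk : F k (q - S s (F^~ q)) = F k q by rewrite raddfB /= F_S// (negbTE ks) subr0.
have := pythagoras k (q - S s (F^~ q)) (F k q).
rewrite Fk subrr normr0 expr0n addr0 -IH// => <-.
by rewrite addrA [L k _ + _]addrC opprD addrA.
Qed.

(** The element [S s v] is its own partial sum along [s], so the residual in Bessel's identity
    vanishes. *)
Let norm_S s v : uniq s -> 'N (S s v) ^+ 2 = T s v.
Proof.
move=> us; rewrite -(bessel (S s v) us).
have e : {in s, forall k, F k (S s v) = v k} by move=> k ks; rewrite F_S// ks.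
have -> : S s (F^~ (S s v)) = S s v.
  by rewrite /S; apply: eq_big_seq => k /e ->.
rewrite subrr normr0 expr0n add0r /T.
by apply: eq_big_seq => k /e ->.
Qed.

Let S_sub s s' v : uniq s -> uniq s' -> {subset s <= s'} ->
  'N (S s' v - S s v) ^+ 2 = T s' v - T s v.
Proof.
move=> us us' ss'.
pose s2 := [seq k <- s' | k \notin s].
have us2 : uniq s2 by rewrite filter_uniq.
have p : perm_eq s' (s ++ s2).
  apply: uniq_perm => //.
    rewrite cat_uniq us us2 andbT/=; apply/hasPn => k.
    by rewrite mem_filter => /andP[].
  move=> k; rewrite mem_cat mem_filter; case ks : (k \in s) => //=.
  by rewrite ss'.
rewrite /S /T !(perm_big _ p)/= !big_cat/= -/(S s v) -/(S s2 v) -/(T s v) -/(T s2 v).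
by rewrite ![_ s v + _]addrC !addrK norm_S.
Qed.

Let T_le s s' v : uniq s -> uniq s' -> {subset s <= s'} -> T s v <= T s' v.
Proof.
by move=> us us' ss'; rewrite -subr_ge0 -(S_sub _ us us' ss') sqr_ge0.
Qed.

Section family.
Variable v : I -> K.
Hypothesis v_finite : (\esum_(k in [set: I]) ('N (v k) ^+ 2)%:E < +oo)%E.
Let t := fine (\esum_(k in [set: I]) ('N (v k) ^+ 2)%:E).

Let tE : (t%:E = \esum_(k in [set: I]) ('N (v k) ^+ 2)%:E)%E.
Proof. by rewrite fineK// ge0_fin_numE// esum_ge0// => k _; rewrite lee_fin sqr_ge0. Qed.

Let T_le_t s : uniq s -> T s v <= t.
Proof.
move=> us; rewrite -lee_fin tE; apply: esum_ge; exists [set` s] => /=.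
  by split => //; exact: finite_seq.
by rewrite -fsbig_seq// sumEFin.
Qed.

Let T_ge_t (e : R) : 0 < e -> exists s, uniq s /\ t - e < T s v.
Proof.
move=> e0; have fin : \esum_(k in [set: I]) ('N (v k) ^+ 2)%:E \is a fin_num by rewrite -tE.
have [_ [A [finA _] <-]] := ub_ereal_sup_adherent e0 fin.
rewrite -/(esum _ _) -tE -EFinB fsbig_finite//= sumEFin lte_fin => h.
by exists (finmap.enum_fset (fset_set A)); split => //; exact: finmap.fset_uniq.
Qed.

(** The exponent [n.*2] makes up for the square root: a defect of [r ^+ n.*2] in [T] bounds the norm
    of a difference by [r ^+ n], the rate asked by [complete]. *)
Let extend s n : uniq s -> exists s', [/\ uniq s', {subset s <= s'} & t - r ^+ n.*2 < T s' v].
Proof.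
move=> us; have [|s' [us' hs']] := @T_ge_t (r ^+ n.*2).
  by rewrite exprn_gt0// invr_gt0.
have uu := undup_uniq (s ++ s'); exists (undup (s ++ s')); split => //.
  by move=> k ks; rewrite mem_undup mem_cat ks.
apply: lt_le_trans hs' _; apply: T_le => // k ks.
by rewrite mem_undup mem_cat ks orbT.
Qed.

Lemma synthesis : exists q, (forall k, F k q = v k) /\ 'N q ^+ 2 <= t.
Proof.
(* The choice is total, with an arbitrary value on sequences with repetitions, so that the nested
   sets can be defined by recursion before they are known to be duplicate-free. *)
have [g gP] : exists g : nat -> seq I -> seq I, forall n s, uniq s ->
    [/\ uniq (g n s), {subset s <= g n s} & t - r ^+ n.*2 < T (g n s) v].
  have /choice[g gP] : forall ns : nat * seq I, exists s', uniq ns.2 ->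
      [/\ uniq s', {subset ns.2 <= s'} & t - r ^+ ns.1.*2 < T s' v].
    move=> [n s] /=; have [us|nus] := boolP (uniq s); last by exists [::].
    by have [s' ?] := extend n us; exists s'.
  by exists (fun n s => g (n, s)) => n s us; exact: (gP (n, s)).
(* Nested finite sets of indices that capture all but [16 ^- n] of the sum. *)
pose fix s n := if n is m.+1 then g n (s m) else g 0%N [::].
have us n : uniq (s n).
  elim: n => [|n IH] /=; first by have [] := gP 0%N [::] isT.
  by have [] := gP n.+1 _ IH.
have ss n : {subset s n <= s n.+1} by have [] := gP n.+1 _ (us n).
have ts n : t - r ^+ n.*2 < T (s n) v.
  by case: n => [|n] /=; [have [] := gP 0%N [::] isT|have [] := gP n.+1 _ (us n)].
have r0 n : 0 <= r ^+ n by rewrite exprn_ge0// invr_ge0.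
have r2 n : r ^+ n.*2 = (r ^+ n) ^+ 2 by rewrite -exprM muln2.
pose u n := S (s n) v.
have [l hl] : exists l, forall n, 'N (l - u n) <= 2 * r ^+ n.
  apply: complete => n; rewrite -ler_sqr ?nnegrE// (S_sub v (us n) (us n.+1) (@ss n)).
  by rewrite -r2; have := T_le_t (us n.+1); have := ts n; lra.
(* The constant 3 adds the distance [2 * r ^+ n] from [u n] to the limit and the defect [r ^+ n] of
   the finite sum. *)
have Fl k : F k l = v k.
  apply/eqP; rewrite -subr_eq0; apply/eqP/N_eq0/(@geometric_le0 _ 3) => n.
  have -> : F k l - v k = F k (l - u n) + (F k (u n) - v k).
    by rewrite raddfB /= addrA subrK.
  apply: le_trans (ND _ _) _; rewrite (_ : 3 * r ^+ n = 2 * r ^+ n + r ^+ n); last by ring.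
  apply: lerD; first exact: le_trans (F_contraction _ _) (hl n).
  (* The coordinate of [u n] is [v k] or 0. In the second case [k] lies outside [s n], so
     ['N (v k) ^+ 2] fits into the defect [t - T (s n) v]. *)
  rewrite F_S//; case: ifPn => ksn; first by rewrite subrr normr0.
  rewrite sub0r normrN -ler_sqr ?nnegrE// -r2.
  have := @T_le_t (k :: s n); rewrite /= ksn us => /(_ isT).
  rewrite /T big_cons -/(T _ _); have := ts n; lra.
(* By Bessel's identity the excess of ['N l ^+ 2] over [t] is at most ['N (l - u n) ^+ 2], hence at
   most [(2 * r ^+ n) ^+ 2], which is below [4 * r ^+ n]. *)
exists l; split=> //; rewrite -subr_le0; apply: (@geometric_le0 _ 4) => n.
have := bessel l (us n).
have -> : F^~ l = v by apply/funext.
rewrite -/(u n) => <-; have := T_le_t (us n).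
have : 'N (l - u n) ^+ 2 <= (2 * r ^+ n) ^+ 2.
  by rewrite ler_sqr ?nnegrE// mulr_ge0.
have : (2 * r ^+ n) ^+ 2 <= 4 * r ^+ n.
  rewrite exprMn expr2 (_ : 2 * 2 = 4 :> R); last by ring.
  by rewrite ler_wpM2l// expr2 ler_piMl// exprn_ile1// invf_le1// ler1n.
lra.
Qed.

End family.

Lemma coord_summable q : (\esum_(k in [set: I]) ('N (F k q) ^+ 2)%:E <= ('N q ^+ 2)%:E)%E.
Proof.
apply: ge_ereal_sup => _ [A [finA _] <-].
rewrite fsbig_finite//= sumEFin lee_fin -(bessel q (finmap.fset_uniq (fset_set A))).
by rewrite lerDr sqr_ge0.
Qed.

Lemma parseval q : (\esum_(k in [set: I]) ('N (F k q) ^+ 2)%:E = ('N q ^+ 2)%:E)%E.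
Proof.
apply/eqP; rewrite eq_le coord_summable /=.
have fin := le_lt_trans (coord_summable q) (ltry _).
have [l [Fl lt]] := synthesis fin.
have -> : q = l.
  apply/eqP; rewrite -subr_eq0; apply/eqP/total => k.
  by rewrite raddfB /= Fl subrr.
under eq_esum do rewrite Fl.
move: lt; rewrite -lee_fin fineK// ge0_fin_numE//.
by apply: esum_ge0 => k _; rewrite lee_fin sqr_ge0.
Qed.

End coordinate_isometry.

(** * Fourier coefficients on an axisymmetric domain *)

Section fibres.
Variables (R : realType) (M : axisymmetric_domain R).
Local Notation B := (measurableTypeR R).
Local Notation mu := (@lebesgue_measure R).
Local Notation D := (`]- pi, pi]%classic : set B).
Local Notation O := (meridian M : set (B * B)).
Local Notation W := (rotate (meridian M) : set (B * B * B)).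

Definition fibre T (f : R * R * R -> T) (p : R * R) (t : R) :=
  f (cylindrical p.1 t p.2).

(** The sum of the squares of the first two coordinates recovers the radius, and a positive radius
    excludes the points of the axis that come from [Gamma0]. *)
Lemma rotate_cylindrical (p : R * R) (t : R) : 0 < p.1 -> D t ->
  W (cylindrical p.1 t p.2) <-> O p.
Proof.
move=> p0 Dt; split=> [[r [t' [z [OG _ e]]]]|Op]; last first.
  exists p.1, t, p.2; split => //; by left; case: p Op p0.
have {e} [e1 e2 ez] : [/\ p.1 * cos t = r * cos t', p.1 * sin t = r * sin t' & p.2 = z].
  by case: e.
have r0 : 0 <= r.
  by case: OG => [/(@meridian_halfplane _ M)/ltW|[/= -> _]].
have pr : p.1 = r.
  apply/eqP; rewrite -(eqrXn2 (ltn0Sn 1)) ?(ltW p0)//; apply/eqP.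
  rewrite -[LHS]mulr1 -(cos2Dsin2 t) -[RHS]mulr1 -(cos2Dsin2 t').
  by rewrite !mulrDr -!exprMn e1 e2.
case: OG => [|[/= rz _]]; first by rewrite -pr -ez; case: p {e1 e2 p0 ez pr}.
by move: p0; rewrite pr rz ltxx.
Qed.

Let mO : measurable O. Proof. exact: measurable_meridian. Qed.
Let mW : measurable W. Proof. exact: measurable_rotate. Qed.
Let mD : measurable D. Proof. by []. Qed.

Let O0 p : O p -> 0 < p.1. Proof. exact: meridian_halfplane. Qed.

Lemma measurable_fibre2 d (T : measurableType d) (g : B * B * B -> T) :
  measurable_fun W g ->
  measurable_fun (O `*` D) (fun pt : B * B * B => fibre g pt.1 pt.2).
Proof.
move=> mg; apply: (measurable_comp mW _ mg).
  by move=> _ [[p t] [Op Dt] <-]; exact/(rotate_cylindrical (O0 Op) Dt).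
apply: measurable_funTS; exact: measurable_cylindrical.
Qed.

Lemma measurable_fibre d (T : measurableType d) (g : B * B * B -> T) p :
  measurable_fun W g -> O p -> measurable_fun D (fibre g p).
Proof.
move=> mg Op; apply: (measurable_comp mW _ mg).
  by move=> _ [t Dt <-]; exact/(rotate_cylindrical (O0 Op) Dt).
apply: measurable_funTS.
exact: (measurable_fun_pair2 p (@measurable_cylindrical R)).
Qed.

Local Open Scope ereal_scope.

Lemma ge0_integral_rotate (g : B * B * B -> \bar R) :
  measurable_fun W g -> (forall x, W x -> 0 <= g x) ->
  \int[lebesgue3 R]_(x in W) g x =
  \int[lebesgue2 R]_(p in O) \int[mu]_(t in D) (fibre g p t * p.1%:E).
Proof.
move=> mg g0; rewrite integral_mkcond ge0_integral_cylindrical; last 2 first.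
- by apply: (measurable_restrictT _ mW).1.
- by move=> x; rewrite patchE; case: ifPn => //; rewrite inE; exact: g0.
rewrite integral_mkcond [RHS]integral_mkcond; apply: eq_integral => p _.
rewrite !patchE; case: ifPn => [|/negP p0].
  rewrite inE/= => p0; case: ifPn => [|/negP]; rewrite inE => Op.
    apply: eq_integral => t; rewrite inE => Dt.
    by rewrite patchE mem_set//; exact/(rotate_cylindrical p0 Dt).
  apply: integral0_eq => t Dt.
  rewrite patchE memNset ?mul0e// => /(rotate_cylindrical p0 Dt).
  exact: Op.
case: ifPn => //; rewrite inE => /O0 p0'; exfalso; apply: p0.
by rewrite inE.
Qed.

(** [Rintegral] is [fine] of a difference of two nonnegative integrals, each measurable by Tonelli.
    Thanks to the default value of [fine], this covers the circles on which the integral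
    diverges. *)
Lemma measurable_Rintegral (G : B * B -> B -> R) :
  measurable_fun (O `*` D) (fun p : B * B * B => G p.1 p.2) ->
  measurable_fun O (fun p => \int[mu]_(t in D) G p t)%R.
Proof.
move=> mG.
have mE : measurable_fun (O `*` D) (fun p : B * B * B => (G p.1 p.2)%:E).
  exact/measurable_EFinP.
have mp : measurable_fun (O `*` D) (fun p : B * B * B => (EFin \o G p.1)^\+ p.2).
  apply: eq_measurable_fun (measurable_funepos mE) => p _.
  by rewrite !funeposE.
have mn : measurable_fun (O `*` D) (fun p : B * B * B => (EFin \o G p.1)^\- p.2).
  apply: eq_measurable_fun (measurable_funeneg mE) => p _.
  by rewrite !funenegE.
have hp := @ge0_measurable_fun_integral _ _ (B * B)%type B R mu O D
  (fun p t => (EFin \o G p)^\+ t) mO mD mp (fun _ _ _ _ => funepos_ge0 _ _).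
have hn := @ge0_measurable_fun_integral _ _ (B * B)%type B R mu O D
  (fun p t => (EFin \o G p)^\- t) mO mD mn (fun _ _ _ _ => funeneg_ge0 _ _).
rewrite (_ : (fun p => _) = fun p => fine (\int[mu]_(t in D) (EFin \o G p)^\+ t -
    \int[mu]_(t in D) (EFin \o G p)^\- t)); last first.
  by apply/funext => p; rewrite /Rintegral [in LHS]integralE.
apply: measurableT_comp => //.
exact: emeasurable_funB.
Qed.

End fibres.

(** * Coefficient functions, lifts, and the integrated norm identity *)

Section angular_operators.
Variables (R : realType) (M : axisymmetric_domain R).
Local Notation B := (measurableTypeR R).
Local Notation mu := (@lebesgue_measure R).
Local Notation D := (`]- pi, pi]%classic : set B).
Local Notation O := (meridian M : set (B * B)).
Local Notation W := (rotate (meridian M) : set (B * B * B)).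
Local Notation W3 := (space_set M).
Local Notation W2 := (meridian_set M).
Local Notation nu3 := (lebesgue3 R).
Local Notation nu2 := (lebesgue2 R).

Let mO : measurable O. Proof. exact: measurable_meridian. Qed.
Let mW : measurable W. Proof. exact: measurable_rotate. Qed.
Let mD : measurable D. Proof. by []. Qed.
Let O0 p : O p -> 0 < p.1. Proof. exact: meridian_halfplane. Qed.

Definition fibre_energy (f : R * R * R -> R[i]) (p : R * R) : \bar R :=
  \int[mu]_(t in D) (normc (fibre f p t) ^+ 2)%:E.

Lemma fibre_energy_ge0 f p : (0 <= fibre_energy f p)%E.
Proof. by apply: integral_ge0 => t _; rewrite lee_fin sqr_ge0. Qed.

Lemma measurable_normc_sqr d (T : measurableType d) (A : set T) (f : T -> R[i]) :
  measurable_fun A (fun x => complex.Re (f x)) ->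
  measurable_fun A (fun x => complex.Im (f x)) ->
  measurable_fun A (fun x => normc (f x) ^+ 2).
Proof.
move=> mr mi.
rewrite (_ : (fun x => _) = fun x => complex.Re (f x) ^+ 2 + complex.Im (f x) ^+ 2).
  by apply: measurable_funD; exact: measurable_funX.
by apply/funext => x; rewrite normc_sqr.
Qed.

Lemma measurable_fibre_normc_sqr f p : measurable_cfun W3 f -> O p ->
  measurable_fun D (fun t => (normc (fibre f p t) ^+ 2)%:E).
Proof.
move=> [mr mi] Op; apply/measurable_EFinP.
have := measurable_normc_sqr mr mi => /measurable_fibre/(_ Op).
exact.
Qed.

Lemma measurable_fibre_energy f : measurable_cfun W3 f ->
  measurable_fun O (fibre_energy f).
Proof.
move=> [mr mi].
have := measurable_normc_sqr mr mi => /measurable_fibre2 m.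
apply: (@ge0_measurable_fun_integral _ _ (B * B)%type B R mu O D
  (fun p t => (normc (fibre f p t) ^+ 2)%:E)) => //.
  exact/measurable_EFinP.
by move=> p t _ _; rewrite lee_fin sqr_ge0.
Qed.

Lemma L2integral_rotate f : measurable_cfun W3 f ->
  (L2integral nu3 W3 f = \int[nu2]_(p in O) (fibre_energy f p * p.1%:E))%E.
Proof.
move=> mf; rewrite /L2integral ge0_integral_rotate; last 2 first.
- exact: (@measurable_sqnorm_density _ _ _ W3).
- by move=> x; exact: (@sqnorm_density_ge0 _ _ _ W3).
apply: eq_integral => p; rewrite inE => Op.
under eq_integral do rewrite /fibre /sqnorm_density mulr1 -/(fibre f p _).
rewrite ge0_integralZr//.
- exact: measurable_fibre_normc_sqr.
- by move=> t _; rewrite lee_fin sqr_ge0.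
- by rewrite lee_fin ltW// O0.
Qed.

(** The energy of the circles, weighted by the radius, is integrable over the meridian domain, hence
    finite almost everywhere; since the radius is positive, so is the energy itself. *)
Lemma ae_circle_L2 f : f \in L2mem nu3 W3 ->
  {ae nu2, forall p, O p -> circle_L2 (fibre f p)}.
Proof.
move=> /L2memP[mf foo]; have [mr mi] := mf.
have me : measurable_fun O (fun p : B * B => fibre_energy f p * p.1%:E)%E.
  apply: emeasurable_funM; first exact: measurable_fibre_energy.
  by apply/measurable_EFinP; exact: measurable_funTS.
have ie : nu2.-integrable O (fun p => fibre_energy f p * p.1%:E)%E.
  apply/integrableP; split => //; move: foo; rewrite L2integral_rotate//.
  under [X in _ -> (X < _)%E]eq_integral.
    move=> p /[!inE] Op; rewrite gee0_abs; first over.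
    by rewrite mule_ge0 ?fibre_energy_ge0// lee_fin ltW// O0.
  exact.
apply: filterS (integrable_ae mO ie) => p h Op; split.
- exact: (measurable_fibre mr Op).
- exact: (measurable_fibre mi Op).
have := h Op; rewrite -/(fibre_energy f p).
have := fibre_energy_ge0 f p; case: (fibre_energy f p) => [r| |]//= _; first by rewrite ltry.
by rewrite gt0_mulye ?lte_fin ?O0.
Qed.

Lemma measurable_fourier_coef f k : measurable_cfun W3 f ->
  measurable_cfun W2 (fourier_coef f k).
Proof.
move=> [mr mi].
have mc : measurable_fun (O `*` D) (fun p : B * B * B => cos (- (k%:~R * p.2)) : R).
  apply: measurable_funTS; apply: (measurableT_comp (@measurable_cos R)).
  by apply: measurable_funN; exact: measurable_funM.
have ms : measurable_fun (O `*` D) (fun p : B * B * B => sin (- (k%:~R * p.2)) : R).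
  apply: measurable_funTS; apply: (measurableT_comp (@measurable_sin R)).
  by apply: measurable_funN; exact: measurable_funM.
have mr2 := measurable_fibre2 mr; have mi2 := measurable_fibre2 mi.
have mre : measurable_fun O (fun p => complex.Re (cintegral (fourier_integrand f k p))).
  apply: measurable_Rintegral.
  apply: (eq_measurable_fun (fun p : B * B * B =>
    complex.Re (fibre f p.1 p.2) * cos (- (k%:~R * p.2)) -
    complex.Im (fibre f p.1 p.2) * sin (- (k%:~R * p.2)))) => [p _|].
    by rewrite /fourier_integrand Re_mul.
  by apply: measurable_funB; exact: measurable_funM.
have mim : measurable_fun O (fun p => complex.Im (cintegral (fourier_integrand f k p))).
  apply: measurable_Rintegral.
  apply: (eq_measurable_fun (fun p : B * B * B =>
    complex.Re (fibre f p.1 p.2) * sin (- (k%:~R * p.2)) +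
    complex.Im (fibre f p.1 p.2) * cos (- (k%:~R * p.2)))) => [p _|].
    by rewrite /fourier_integrand Im_mul.
  by apply: measurable_funD; exact: measurable_funM.
split.
- apply: (eq_measurable_fun (fun p => (Num.sqrt (2 * pi))^-1 *
    complex.Re (cintegral (fourier_integrand f k p)))) => [p _|].
    by rewrite /fourier_coef Re_mul /= mul0r subr0.
  exact: measurable_funM.
- apply: (eq_measurable_fun (fun p => (Num.sqrt (2 * pi))^-1 *
    complex.Im (cintegral (fourier_integrand f k p)))) => [p _|].
    by rewrite /fourier_coef Im_mul /= mul0r addr0.
  exact: measurable_funM.
Qed.

Definition radius (x : R * R * R) : R := Num.sqrt (x.1.1 ^+ 2 + x.1.2 ^+ 2).

(* [(x / r + i y / r) ^ k], without a choice of the angle; it vanishes on the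
   axis when [k <> 0]. *)
Definition turn (k : int) (x : R * R * R) : R[i] :=
  match k with
  | Posz n => ((x.1.1 / radius x) +i* (x.1.2 / radius x)) ^+ n
  | Negz n => ((x.1.1 / radius x) +i* (- (x.1.2 / radius x))) ^+ n.+1
  end.

(** The function [v * e k] in Cartesian coordinates. The membership test extends [v] by zero, which
    makes the lift measurable on the whole space although [v] is controlled only on the meridian
    domain. *)
Definition angular_lift (k : int) (v : R * R -> R[i]) (x : R * R * R) : R[i] :=
  (if (radius x, x.2) \in meridian M then v (radius x, x.2) else 0) *
  (((Num.sqrt (2 * pi))^-1)%:C * turn k x).

Lemma radius_cylindrical (p : R * R) (t : R) : 0 < p.1 ->
  radius (cylindrical p.1 t p.2) = p.1.
Proof.
move=> p0; rewrite /radius /= !exprMn -mulrDr cos2Dsin2 mulr1.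
by rewrite sqrtr_sqr gtr0_norm.
Qed.

Lemma expiX (t : R) n : expi t ^+ n = expi (n%:R * t).
Proof.
elim: n => [|n IH]; last by rewrite exprS IH -expiD -nat1r mulrDl mul1r.
by rewrite expr0 mul0r /expi cos0 sin0.
Qed.

Lemma turn_cylindrical k (p : R * R) (t : R) : 0 < p.1 ->
  turn k (cylindrical p.1 t p.2) = expi (k%:~R * t).
Proof.
move=> p0; have c0 (u : R) : p.1 * u / p.1 = u by rewrite mulrAC divff ?mul1r// gt_eqF.
case: k => n; rewrite /turn radius_cylindrical//= !c0.
  exact: expiX.
by rewrite -sinN -{1}[cos t]cosN -/(expi (- t)) (expiX (- t) n.+1) NegzE rmorphN mulrN mulNr.
Qed.

Lemma fibre_lift k v p t : O p ->
  fibre (angular_lift k v) p t = v p * circle_basis k t.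
Proof.
move=> Op; rewrite /fibre /angular_lift radius_cylindrical ?turn_cylindrical ?O0//=.
by rewrite -surjective_pairing mem_set.
Qed.

Lemma measurable_radius : measurable_fun [set: B * B * B] (radius : B * B * B -> B).
Proof.
apply: (measurableT_comp (f := @Num.sqrt R)).
  by apply: continuous_measurable_fun; exact: sqrt_continuous.
apply: measurable_funD; apply: measurable_funX;
  [exact: (measurableT_comp measurable_fst)|exact: (measurableT_comp measurable_snd)].
Qed.

Let mC d (T : measurableType d) (f : T -> R[i]) :=
  measurable_fun [set: T] (fun x => complex.Re (f x)) /\
  measurable_fun [set: T] (fun x => complex.Im (f x)).

Let mC_mul d (T : measurableType d) (f g : T -> R[i]) : mC f -> mC g ->
  mC (fun x => f x * g x).
Proof.
move=> [fr fi] [gr gi]; split.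
- apply: (eq_measurable_fun (fun x => complex.Re (f x) * complex.Re (g x) -
    complex.Im (f x) * complex.Im (g x))) => [x _|]; first by rewrite Re_mul.
  by apply: measurable_funB; exact: measurable_funM.
- apply: (eq_measurable_fun (fun x => complex.Re (f x) * complex.Im (g x) +
    complex.Im (f x) * complex.Re (g x))) => [x _|]; first by rewrite Im_mul.
  by apply: measurable_funD; exact: measurable_funM.
Qed.

Let mC_exp d (T : measurableType d) (f : T -> R[i]) n : mC f -> mC (fun x => f x ^+ n).
Proof.
move=> mf; elim: n => [|n IH].
  by split; exact: measurable_cst.
rewrite (_ : (fun x => _) = fun x => f x * f x ^+ n); first exact: mC_mul.
by apply/funext => x; rewrite exprS.
Qed.

Lemma measurable_lift k v : measurable_cfun W2 v -> measurable_cfun W3 (angular_lift k v).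
Proof.
move=> [vr vi].
have mrV := measurable_funV measurable_radius.
have mc : measurable_fun [set: B * B * B] (fun x : B * B * B => x.1.1 / radius x).
  by apply: measurable_funM => //; exact: (measurableT_comp measurable_fst).
have ms : measurable_fun [set: B * B * B] (fun x : B * B * B => x.1.2 / radius x).
  by apply: measurable_funM => //; exact: (measurableT_comp measurable_snd).
have mturn : mC (turn k : B * B * B -> R[i]).
  by case: k => n; apply: mC_exp; split => //=; exact: measurable_funN.
have mrz : measurable_fun [set: B * B * B] (fun x : B * B * B => (radius x, x.2) : B * B).
  by apply: measurable_fun_pair => //; exact: measurable_radius.
have mv : mC (fun x : B * B * B =>
    if (radius x, x.2) \in O then v (radius x, x.2) else 0).
  have aux (F : R[i] -> R) : F 0 = 0 -> measurable_fun O (fun p => F (v p)) ->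
      measurable_fun [set: B * B * B] (fun x : B * B * B =>
        F (if (radius x, x.2) \in O then v (radius x, x.2) else 0)).
    move=> F0 mF.
    have mF' : measurable_fun setT ((fun p => F (v p)) \_ O).
      by apply: (measurable_restrictT _ mO).1.
    apply: eq_measurable_fun (measurableT_comp mF' mrz) => x _ /=.
    by rewrite patchE; case: ifP.
  by split; exact: aux.
have ml : mC (angular_lift k v : B * B * B -> R[i]).
  by apply: mC_mul => //; exact: mC_mul.
by split; apply: measurable_funTS; [exact: ml.1|exact: ml.2].
Qed.

(** The identity of [circle_bessel] on almost every circle, with [c := v p], is multiplied by the
    radius and integrated. It is an equality of sums in the extended reals, valid for measurable
    [v], so it can serve to prove that coefficients and lifts have finite norm. *)
Lemma L2integral_pythagoras k f v : f \in L2mem nu3 W3 -> measurable_cfun W2 v ->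
  (L2integral nu3 W3 (f - angular_lift k v)%R + L2integral nu2 W2 (fourier_coef f k) =
   L2integral nu3 W3 f + L2integral nu2 W2 (fourier_coef f k - v)%R)%E.
Proof.
move=> fL mv; have /L2memP[mf _] := fL.
have mFf := measurable_fourier_coef k mf.
have ml := measurable_lift k mv.
have mfl : measurable_cfun W3 (f - angular_lift k v).
  by have := measurable_cfun_lin (-1) ml mf; rewrite scaleN1r addrC.
have mFv : measurable_cfun W2 (fourier_coef f k - v).
  by have := measurable_cfun_lin (-1) mv mFf; rewrite scaleN1r addrC.
have menergy g : measurable_cfun W3 g ->
    measurable_fun O (fun p : B * B => fibre_energy g p * p.1%:E)%E.
  move=> mg; apply: emeasurable_funM; first exact: measurable_fibre_energy.
  by apply/measurable_EFinP; exact: measurable_funTS.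
have energy0 g p : O p -> (0 <= fibre_energy g p * p.1%:E)%E.
  by move=> Op; rewrite mule_ge0 ?fibre_energy_ge0// lee_fin ltW// O0.
have dens0 g p : O p -> (0 <= sqnorm_density W2 g p)%E.
  exact: (@sqnorm_density_ge0 _ _ _ W2).
have mdFf := measurable_sqnorm_density mFf.
have mdFv := measurable_sqnorm_density mFv.
have mef := menergy _ mf; have mefl := menergy _ mfl.
rewrite !L2integral_rotate// /L2integral.
rewrite -(ge0_integralD nu2 mO (energy0 _) mefl (dens0 _) mdFf).
rewrite -(ge0_integralD nu2 mO (energy0 _) mef (dens0 _) mdFv).
apply: ge0_ae_eq_integral => //.
- by apply: emeasurable_funD; [exact: mefl|exact: mdFf].
- by apply: emeasurable_funD; [exact: mef|exact: mdFv].
- by move=> p Op; rewrite adde_ge0 ?energy0//; exact: dens0.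
- by move=> p Op; rewrite adde_ge0 ?energy0//; exact: dens0.
apply: filterS (ae_circle_L2 fL) => p h Op.
have e (g : B * B -> R[i]) :
    sqnorm_density W2 g p = ((normc (g p) ^+ 2)%:E * p.1%:E)%E by rewrite -EFinM.
rewrite !e -!ge0_muleDl ?fibre_energy_ge0 ?lee_fin ?sqr_ge0//.
congr (_ * _)%E; refine (etrans _ (circle_bessel k (v p) (h Op))).
congr (_ + _)%E; apply: eq_integral => t _.
by rewrite -(fibre_lift k v t Op).
Qed.

End angular_operators.

(** * Passage to classes and the Fourier map *)

Section Fourier_classes.
Variables (R : realType) (M : axisymmetric_domain R).
Local Notation B := (measurableTypeR R).
Local Notation D := (`]- pi, pi]%classic : set B).
Local Notation O := (meridian M : set (B * B)).
Local Notation W3 := (space_set M).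
Local Notation W2 := (meridian_set M).
Local Notation nu3 := (lebesgue3 R).
Local Notation nu2 := (lebesgue2 R).
Local Notation X3 := (L2fun nu3 W3).
Local Notation X2 := (L2fun nu2 W2).
Local Notation "''N' x" := (complex.Re `|x|) (at level 10, x at level 8).

Lemma L2integral_fourier_coef_le f k : f \in L2mem nu3 W3 ->
  (L2integral nu2 W2 (fourier_coef f k) <= L2integral nu3 W3 f)%E.
Proof.
move=> fL; have /L2memP[mf _] := fL.
have := L2integral_pythagoras k fL (measurable_fourier_coef k mf).
rewrite subrr [X in (_ = _ + X)%E]integral0_eq ?adde0 => [<-|p _].
  by rewrite leeDr// L2integral_ge0.
by rewrite /sqnorm_density Normc.normc0 expr0n mul0r.
Qed.

Lemma fourier_coef_mem f k : f \in L2mem nu3 W3 -> fourier_coef f k \in L2mem nu2 W2.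
Proof.
move=> fL; have /L2memP[mf foo] := fL.
apply/L2memP; split; first exact: measurable_fourier_coef.
exact: le_lt_trans (L2integral_fourier_coef_le k fL) foo.
Qed.

Lemma fourier_coef0 k : fourier_coef (0 : B * B * B -> R[i]) k = 0.
Proof.
apply/funext => p; rewrite /fourier_coef /cintegral.
have -> : fourier_integrand (0 : B * B * B -> R[i]) k p = fun=> 0.
  by apply/funext => t; rewrite /fourier_integrand mul0r.
by rewrite /= !Rintegral_cst// !mul0r mulr0.
Qed.

(** At [f = 0] the norm identity says that the lift has the same norm as [v]. *)
Lemma lift_mem v k : v \in L2mem nu2 W2 -> angular_lift M k v \in L2mem nu3 W3.
Proof.
move=> /L2memP[mv voo]; have ml := measurable_lift k mv.
apply/L2memP; split => //.
have neg d (T : measurableType d) (m : {measure set T -> \bar R}) (W : weighted_set T R)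
    (g : T -> R[i]) : L2integral m W (0 - g)%R = L2integral m W g.
  apply: eq_integral => x _; rewrite /sqnorm_density -[(0 - g)%R x]/(0 - g x).
  by rewrite sub0r -mulN1r normcZ (_ : normc (-1) = 1) ?mul1r// /normc /= oppr0 expr0n addr0 sqrrN expr1n sqrtr1.
have := L2integral_pythagoras k (L2mem0 nu3 W3) mv.
rewrite fourier_coef0 !neg => e; apply: le_lt_trans voo.
have zero d (T : measurableType d) (m : {measure set T -> \bar R}) (W : weighted_set T R) :
    L2integral m W (0 : T -> R[i]) = 0%E.
  by apply: integral0_eq => x _; rewrite /sqnorm_density Normc.normc0 expr0n mul0r.
by move: e; rewrite !zero adde0 add0e => ->.
Qed.

Definition fourier_fun k (f : X3) : X2 := L2Fun (fourier_coef_mem k (L2fun_mem f)).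
Definition lift_fun k (v : X2) : X3 := L2Fun (lift_mem k (L2fun_mem v)).

Lemma norm_L2class d (T : measurableType d) (m : {measure set T -> \bar R})
  (W : weighted_set T R) (f : L2fun m W) : `|L2class f| = (L2fun_norm f)%:C.
Proof. exact: L2norm_class. Qed.

Lemma L2class0 d (T : measurableType d) (m : {measure set T -> \bar R})
  (W : weighted_set T R) : L2class (0 : L2fun m W) = 0.
Proof. by apply: (addrI (L2class (0 : L2fun m W))); rewrite -L2classD !addr0. Qed.

Lemma L2class_lin d (T : measurableType d) (m : {measure set T -> \bar R})
  (W : weighted_set T R) c (f g : L2fun m W) :
  L2class (c *: f + g) = c *: L2class f + L2class g.
Proof. by rewrite L2classD L2classZ. Qed.

Lemma L2class_fourier_fun_lin k c (f g : X3) :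
  L2class (fourier_fun k (c *: f + g)) =
  c *: L2class (fourier_fun k f) + L2class (fourier_fun k g).
Proof.
rewrite -L2class_lin; apply/L2classP.
apply: filterS2 (ae_circle_L2 (L2fun_mem f)) (ae_circle_L2 (L2fun_mem g)) => p hf hg Op.
exact: (circle_coef_lin c k (hf Op) (hg Op)).
Qed.

Lemma L2fun_norm_fourier_le k (f : X3) : L2fun_norm (fourier_fun k f) <= L2fun_norm f.
Proof.
apply: ler_wsqrtr; rewrite fine_le ?ge0_fin_numE ?L2integral_ge0//.
- by have /L2memP[] := L2fun_mem (fourier_fun k f).
- by have /L2memP[] := L2fun_mem f.
- exact: (L2integral_fourier_coef_le k (L2fun_mem f)).
Qed.

(** Independence of the representative comes from linearity and contraction: the coefficient of a
    difference of null norm has null norm. This avoids a Fubini argument on null sets. *)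
Lemma L2class_fourier_fun k (f f' : X3) : L2class f = L2class f' ->
  L2class (fourier_fun k f) = L2class (fourier_fun k f').
Proof.
move=> ff'; apply/eqP; rewrite -subr_eq0 -normr_le0.
have -> : L2class (fourier_fun k f) - L2class (fourier_fun k f') =
    L2class (fourier_fun k (-1 *: f' + f)).
  apply: esym; apply: (etrans (L2class_fourier_fun_lin k (-1) f' f)).
  by rewrite [X in X + _]scaleN1r; exact: addrC.
rewrite norm_L2class; apply: (@le_trans _ _ (L2fun_norm (-1 *: f' + f))%:C).
  by rewrite lecR L2fun_norm_fourier_le.
rewrite -norm_L2class (L2class_lin (-1) f' f) ff'.
by rewrite [X in X + _]scaleN1r addNr normr0.
Qed.

Definition fourier_class k (q : L2_space M) : L2_1 M := L2class (fourier_fun k (repr q)).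
Definition lift_class k (v : L2_1 M) : L2_space M := L2class (lift_fun k (repr v)).

Lemma fourier_classE k (f : X3) : fourier_class k (L2class f) = L2class (fourier_fun k f).
Proof. by apply: L2class_fourier_fun; rewrite L2class_repr. Qed.

Lemma fourier_class_linear k : linear (fourier_class k).
Proof.
move=> c p q; rewrite -[p]L2class_repr -[q]L2class_repr -L2class_lin !fourier_classE.
exact: L2class_fourier_fun_lin.
Qed.

Lemma fourier_class_pythagoras k (q : L2_space M) (v : L2_1 M) :
  'N (q - lift_class k v) ^+ 2 + 'N (fourier_class k q) ^+ 2 =
  'N q ^+ 2 + 'N (fourier_class k q - v) ^+ 2.
Proof.
have classB d (T : measurableType d) (m : {measure set T -> \bar R})
    (W : weighted_set T R) (f g : L2fun m W) :
    L2class f - L2class g = L2class (f - g).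
  by rewrite addrC -scaleN1r -L2class_lin scaleN1r addrC.
rewrite /lift_class; set f := repr q; set w := repr v.
rewrite -(L2class_repr q) -/f -(L2class_repr v) -/w fourier_classE !classB !norm_L2class /=.
apply: EFin_inj; rewrite !EFinD -!L2integral_norm.
exact: (L2integral_pythagoras k (L2fun_mem f) (L2fun_measurable w)).
Qed.

Lemma fourier_class_lift j k (v : L2_1 M) :
  fourier_class j (lift_class k v) = if j == k then v else 0.
Proof.
rewrite /lift_class fourier_classE; set w := repr v.
have -> : (if j == k then v else 0) = L2class (if j == k then w else 0).
  case: eqP => _; first by rewrite L2class_repr.
  by rewrite L2class0.
apply/L2classP; apply: aeW => p Op.
transitivity (circle_coef (fun t => w p * circle_basis k t) j); last first.
  by rewrite circle_coef_basis; case: eqP.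
rewrite /circle_coef; congr (_ * cintegral _); apply/funext => t.
by rewrite -(fibre_lift k w t Op).
Qed.

Lemma fourier_class_total (q : L2_space M) : (forall k, fourier_class k q = 0) -> q = 0.
Proof.
rewrite -[q]L2class_repr; set f := repr q => h.
have mf := L2fun_measurable f.
have ae0 k : {ae nu2, forall p, O p -> fourier_coef f k p = 0}.
  have /L2classP : L2class (fourier_fun k f) = L2class (0 : X2).
    by rewrite -fourier_classE h L2class0.
  by apply: filterS => p h' Op; exact: h'.
(* The indices are countable, so the quantifier over [k] moves inside the almost everywhere
   statement; [odflt 0] handles the numbers that encode no integer. *)
have ae0all : {ae nu2, forall p, O p -> forall k, fourier_coef f k p = 0}.
  have : {ae nu2, forall p n, O p -> fourier_coef f (odflt 0 (unpickle n)) p = 0}.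
    by apply/ae_foralln => n; exact: ae0.
  apply: filterS => p h' Op k.
  by have := h' (pickle k) Op; rewrite pickleK.
have I0 : L2integral nu3 W3 f = 0%E.
  rewrite L2integral_rotate// (@ae_eq_integral _ _ _ nu2 O (cst 0%E))//.
  - exact: integral0.
  - exact: measurable_meridian.
  - apply: emeasurable_funM; first exact: measurable_fibre_energy.
    by apply/measurable_EFinP; exact: measurable_funTS.
  apply: filterS2 (ae_circle_L2 (L2fun_mem f)) ae0all => p hf h0 Op.
  have z := circle_coef_ae0 (hf Op) (h0 Op).
  rewrite /= /fibre_energy (@ae_eq_integral _ _ _ lebesgue_measure D (cst 0%E))//.
  - by rewrite integral0 mul0e.
  - exact: (measurable_fibre_normc_sqr mf Op).
  - have aeF := ae_filter_ringOfSetsType (@lebesgue_measure R).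
    by apply: filterS z => t z Dt; rewrite z// Normc.normc0 expr0n.
apply/normr0_eq0; rewrite norm_L2class /L2fun_norm I0 /=.
by rewrite sqrtr0.
Qed.

Lemma L2_space_complete (u : nat -> L2_space M) :
  (forall n, 'N (u n.+1 - u n) <= 4^-1 ^+ n) ->
  exists l, forall n, 'N (l - u n) <= 2 * 4^-1 ^+ n.
Proof.
have classB (f g : X3) : L2class f - L2class g = L2class (f - g).
  by rewrite addrC -scaleN1r -L2class_lin scaleN1r addrC.
have uE n : u n = L2class (repr (u n)) by rewrite L2class_repr.
move=> hu; have [|g hg] := @L2fun_complete_fast _ _ _ nu3 W3 (fun n => repr (u n)).
  by move=> n; have := hu n; rewrite [u n.+1]uE [u n]uE classB norm_L2class !L2class_repr.
exists (L2class g) => n; rewrite [u n]uE classB norm_L2class.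
exact: hg.
Qed.

Let synthesisM := synthesis fourier_class_linear fourier_class_pythagoras
  fourier_class_lift L2_space_complete.
Let parsevalM := parseval fourier_class_linear fourier_class_pythagoras
  fourier_class_lift fourier_class_total L2_space_complete.

Lemma fourier_class_finite (q : L2_space M) :
  (@l2sq _ _ (L2_ M) (fun k => fourier_class k q) < +oo)%E.
Proof. by rewrite /l2sq parsevalM ltry. Qed.

Definition fourier_map (q : L2_space M) : l2sum (L2_ M) := L2Sum (fourier_class_finite q).

Lemma fourier_map_linear : linear fourier_map.
Proof. by move=> c p q; apply: l2sum_eq => k /=; rewrite fourier_class_linear. Qed.

HB.instance Definition _ :=
  GRing.isLinear.Build R[i] (L2_space M) (l2sum (L2_ M)) *:%R fourier_map fourier_map_linear.

Lemma fourier_map_inj : injective fourier_map.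
Proof.
move=> p q pq; apply/eqP; rewrite -subr_eq0; apply/eqP/fourier_class_total => k.
have e : fourier_class k p = fourier_class k q :=
  congr1 (fun x : l2sum (L2_ M) => x k) pq.
rewrite addrC -scaleN1r (fourier_class_linear k (-1) q p) e.
by rewrite [X in X + _]scaleN1r addNr.
Qed.

Lemma fourier_map_bij : bijective fourier_map.
Proof.
have sur (x : l2sum (L2_ M)) : exists q, fourier_map q = x.
  have [q [qx _]] := synthesisM (l2seq_finite x).
  by exists q; apply: l2sum_eq.
have /choice[g gK] := sur.
by exists g => // q; apply: fourier_map_inj; rewrite gK.
Qed.

Lemma norm_fourier_map (q : L2_space M) :
  `|q| = (Num.sqrt (fine (\esum_(k in [set: int])
            (complex.Re `|fourier_map q k| ^+ 2)%:E)))%:C.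
Proof.
rewrite parsevalM [fine _]/= sqrtr_sqr.
have e (f : X3) : `|L2fun_norm f| = L2fun_norm f := ger0_norm (L2fun_norm_ge0 f).
by rewrite -(L2class_repr q) norm_L2class /= e L2class_repr.
Qed.

Lemma fourier_map_coef (q : L2_space M) (k : int) : is_fourier_coef q (fourier_map q k).
Proof.
move=> f g fq gv.
have /L2classP gf : L2class g = L2class (fourier_fun k f).
  by rewrite gv -fourier_classE fq.
apply: filterS2 gf (ae_circle_L2 (L2fun_mem f)) => p gf hf Op; split.
  exact: (circle_L2_cintegrable k (hf Op)).
exact: gf.
Qed.

End Fourier_classes.

Theorem theorem5p2 (R : realType) (M : axisymmetric_domain R) :
  exists F : {linear L2_space M -> l2sum (L2_ M)},
    [/\ forall (q : L2_space M) (k : int), is_fourier_coef q (F q k),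
        bijective F,
        forall q : L2_space M,
          `|q| = (Num.sqrt (fine (\esum_(k in [set: int])
                    (complex.Re `|F q k| ^+ 2)%:E)))%:C &
        forall q : L2_space M, `|q| = `|F q|].
Proof.
exists (@fourier_map R M : {linear L2_space M -> l2sum (L2_ M)}); split.
- exact: fourier_map_coef.
- exact: fourier_map_bij.
- exact: norm_fourier_map.
(* The norm of [l2sum] unfolds to the square root of the sum, so the same lemma applies. *)
- exact: norm_fourier_map.
Qed.
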